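(* Let $\Gamma$ be a tropical curve equipped with a fixed model $G_0$, and let $R(G_0)$ be the collection of weighted graphs that admit a common refinement with $G_0$ (i.e. the models of $\Gamma$). Then there is a canonical isomorphism $$\varinjlim_{G \in R(G_0)} J(G) \;\xrightarrow{\ \sim\ }\; J(\Gamma),$$ induced by the maps $J(G)\to \Omega(G)^*/H_1(G,\mathbb{Z})\cong \Omega(\Gamma)^*/H_1(\Gamma,\mathbb{Z}) = J(\Gamma)$. Moreover, for each $G \in R(G_0)$ this isomorphism induces a canonical inclusion $J(G) \hookrightarrow J(\Gamma)$.
   Context: A weighted graph $G$ is a finite connected multigraph (loops and multiple edges allowed) with nonempty finite vertex set $V(G)$, finite edge set $E(G)$, a length function $\ell : E(G) \to \mathbb{R}_{>0}$, and a fixed orientation: each edge $e$ has a tail $e^-$ and a head $e^+$. For $A \in \{\mathbb{Z},\mathbb{R}\}$, $C_1(G,A)$ is the free $A$-module on $E(G)$. Let $(d^*\alpha)(x) = \sum_{e : e^+ = x}\alpha(e) - \sum_{e : e^-=x}\alpha(e)$, $H_1(G,\mathbb{R}) = \ker(d^* )$, $H_1(G,\mathbb{Z}) = \ker(d^* )\cap C_1(G,\mathbb{Z})$. A 1-form $\omega = \sum_e \omega_e\, de$ (formal real combination of symbols $de$, $e\in E(G)$) is harmonic if $\sum_{e: e^+=x}\omega_e = \sum_{e : e^-=x}\omega_e$ for all vertices $x$; $\Omega(G)$ is the space of harmonic 1-forms. Integration is bilinear with $\int_{e'} de = \ell(e)$ if $e=e'$ and $0$ otherwise; each $\alpha\in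 C_1(G,\mathbb{R})$ gives $\int_\alpha \in \Omega(G)^*$. The map $\alpha\mapsto\int_\alpha$ is an isomorphism $H_1(G,\mathbb{R})\to\Omega(G)^*$, through which $H_1(G,\mathbb{Z})$ is viewed as a subgroup of $\Omega(G)^*$. Put $\Omega(G)^\sharp = \{\int_\alpha : \alpha \in C_1(G,\mathbb{Z})\}$ and $J(G) = \Omega(G)^\sharp / H_1(G,\mathbb{Z})$. $G_2$ refines $G_1$ (written $G_1\le G_2$) if it is obtained by subdividing edges of $G_1$ in a length-preserving way, with the induced orientation. If $e\in E(G_1)$ is subdivided into $e_1,\dots,e_n\in E(G_2)$, put $r(e)=\sum_i e_i$ and $r_*(de)=\sum_i de_i$. Then $r_*$ gives an isomorphism $\Omega(G_1)\cong\Omega(G_2)$ and $r$ gives an isomorphism $H_1(G_1,\mathbb{Z})\cong H_1(G_2,\mathbb{Z})$; $[\int_\alpha]\mapsto[\int_{r(\alpha)}]$ gives injective transition maps $J(G_1)\to J(G_2)$ and isomorphisms $\Omega(G_1)^*/H_1(G_1,\mathbb{Z})\cong\Omega(G_2)^*/H_1(G_2,\mathbb{Z})$. A tropical curve (equivalently metric graph) $\Gamma$ is a compact connected metric space, with its path metric, in which every point $p$ has a neighborhood isometric to a star-shaped set of some valence $n_p\ge 1$ ($n_p$ half-open intervals $[0,r_p)$ glued at $0$). A model of $\Gamma$ is a weighted graph whose geometric realization (gluing segments $[0,\ell(e)]$ according to endpoints) is $\Gamma$; it corresponds to a finite nonempty vertex set containing all points of valence $\ne 2$. A preferred model $G_0$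 is fixed, and all other models are oriented compatibly with $G_0$ (so that they have a common refinement with $G_0$). $\Omega(\Gamma)=\varinjlim_{G\in R(G_0)}\Omega(G)$ under the isomorphisms $r_*$ (so $\Omega(\Gamma)\cong\Omega(G_0)$), and $J(\Gamma)=\Omega(\Gamma)^*/H_1(\Gamma,\mathbb{Z})$, where $H_1(\Gamma,\mathbb{Z})=H_1(G_0,\mathbb{Z})$ is embedded in $\Omega(\Gamma)^*$ by integration. *)

(* Defs.v *)
From HB Require Import structures.
From mathcomp Require Import all_boot all_order all_algebra generic_quotient ring_quotient.
From mathcomp Require Import all_classical all_reals all_analysis.

Set Implicit Arguments.
Unset Strict Implicit.
Unset Printing Implicit Defensive.

Import Order.TTheory GRing.Theory Num.Theory.
Import numFieldNormedType.Exports.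

Local Open Scope classical_set_scope.
Local Open Scope ring_scope.

(* The colimit of a diagram of K-modules, indexed by a type I of objects and a
   family of types of arrows, is the quotient of the direct sum of the M i by
   the submodule generated by the differences (x in degree i) - (f u x in
   degree j), for the arrows u : hom i j. For a directed system this is the
   usual direct limit. *)
Section Colimit.
Variables (K : nzRingType) (I : Type) (hom : I -> I -> Type).
Variables (M : I -> lmodType K) (f : forall i j, hom i j -> M i -> M j).

Definition dprod : Type := forall i, M i.

HB.instance Definition _ := gen_eqMixin dprod.
HB.instance Definition _ := gen_choiceMixin dprod.

Let dadd (x y : dprod) : dprod := fun i => x i + y i.
Let dopp (x : dprod) : dprod := fun i => - x i.
Let dscale (a : K) (x : dprod) : dprod := fun i => a *: x i.

Fact dprod_addA : associative dadd.
Proof. by move=> x y z; apply/functional_extensionality_dep => i; exact: addrA. Qed.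
Fact dprod_addC : commutative dadd.
Proof. by move=> x y; apply/functional_extensionality_dep => i; exact: addrC. Qed.
Fact dprod_add0 : left_id (fun=> 0) dadd.
Proof. by move=> x; apply/functional_extensionality_dep => i; exact: add0r. Qed.
Fact dprod_addN : left_inverse (fun=> 0) dopp dadd.
Proof. by move=> x; apply/functional_extensionality_dep => i; exact: addNr. Qed.

HB.instance Definition _ :=
  GRing.isZmodule.Build dprod dprod_addA dprod_addC dprod_add0 dprod_addN.

Fact dprod_scaleA a b x : dscale a (dscale b x) = dscale (a * b) x.
Proof. by apply/functional_extensionality_dep => i; exact: scalerA. Qed.
Fact dprod_scale1 : left_id 1 dscale.
Proof. by move=> x; apply/functional_extensionality_dep => i; exact: scale1r. Qed.
Fact dprod_scaleDr : right_distributive dscale +%R.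
Proof. by move=> a x y; apply/functional_extensionality_dep => i; exact: scalerDr. Qed.
Fact dprod_scaleDl x : {morph dscale^~ x : a b / a + b}.
Proof. by move=> a b; apply/functional_extensionality_dep => i; exact: scalerDl. Qed.

HB.instance Definition _ := GRing.Zmodule_isLmodule.Build K dprod
  dprod_scaleA dprod_scale1 dprod_scaleDr dprod_scaleDl.

Definition finsupp : {pred dprod} :=
  [pred x : dprod | `[< finite_set [set i | x i <> 0] >]].

Fact finsupp_closed : submod_closed finsupp.
Proof.
split=> [|a x y /asboolP fx /asboolP fy]; apply/asboolP.
  by rewrite (_ : [set _ | _] = set0) // -subset0 => i /=.
apply: (@sub_finite_set _ _ ([set i | x i <> 0] `|` [set i | y i <> 0])).
  move=> i /= xy; have [x0|] := pselect (x i = 0); last by left.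
  by right=> y0; apply: xy; rewrite -[LHS]/(a *: x i + y i) x0 y0 scaler0 addr0.
by rewrite finite_setU.
Qed.

HB.instance Definition _ := GRing.isSubmodClosed.Build K dprod finsupp finsupp_closed.

Record dsum : Type := DSum { dsum_val :> dprod; _ : dsum_val \in finsupp }.

HB.instance Definition _ := [isSub for dsum_val].
HB.instance Definition _ := [Choice of dsum by <:].
HB.instance Definition _ := [SubChoice_isSubLmodule of dsum by <:].

Definition single_fun i (x : M i) : dprod := fun j =>
  if pselect (i = j) is left e then ecast k (M k) e x else 0.

Fact single_subproof i (x : M i) : single_fun x \in finsupp.
Proof.
apply/asboolP; apply: (@sub_finite_set _ _ [set i]) => // j /=.
by rewrite /single_fun; case: pselect.
Qed.

Definition single i (x : M i) : dsum := DSum (single_subproof x).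

Definition colim_rel : set dsum :=
  [set z | exists i j (u : hom i j) (x : M i), z = single x - single (f u x)].

(* the submodule generated by colim_rel *)
Definition colim_null : {pred dsum} := [pred x : dsum |
  `[< forall A : {pred dsum}, submod_closed A -> colim_rel `<=` [set` A] -> x \in A >]].

Fact colim_null_closed : submod_closed colim_null.
Proof.
split=> [|a x y /asboolP xA /asboolP yA]; apply/asboolP => A cA sA.
  by case: cA.
by case: (cA) => _; apply; [exact: xA|exact: yA].
Qed.

HB.instance Definition _ := GRing.isSubmodClosed.Build K dsum colim_null colim_null_closed.

Definition colim : Type := Quotient.quot colim_null.
HB.instance Definition _ := GRing.Zmodule.on colim.

Definition colim_pi (x : dsum) : colim := \pi_(Quotient.quot colim_null)%qT x.


Lemma colim_piE x y : (colim_pi x == colim_pi y) = (x - y \in colim_null).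
Proof. by rewrite Quotient.idealrBE. Qed.

Fact colim_pi_is_additive : zmod_morphism colim_pi.
Proof. exact: raddfB (\pi_(Quotient.quot colim_null)%qT). Qed.

HB.instance Definition _ := GRing.isZmodMorphism.Build dsum colim colim_pi
  colim_pi_is_additive.

Definition colim_repr (x : colim) : dsum := repr (x : Quotient.quot colim_null).

Lemma colim_reprK : cancel colim_repr colim_pi.
Proof. by move=> x; exact: (@reprK _ (Quotient.quot colim_null) x). Qed.

Definition colim_scale (a : K) (x : colim) : colim := colim_pi (a *: colim_repr x).

Lemma colim_scaleE a x : colim_scale a (colim_pi x) = colim_pi (a *: x).
Proof.
apply/eqP; rewrite colim_piE -scalerBr rpredZ// -colim_piE.
by rewrite colim_reprK.
Qed.

Fact colim_scaleA a b x : colim_scale a (colim_scale b x) = colim_scale (a * b) x.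
Proof. by rewrite -[x]colim_reprK !colim_scaleE scalerA. Qed.
Fact colim_scale1 : left_id 1 colim_scale.
Proof. by move=> x; rewrite -[x]colim_reprK !colim_scaleE scale1r. Qed.
Fact colim_scaleDr : right_distributive colim_scale +%R.
Proof.
move=> a x y; rewrite -[x]colim_reprK -[y]colim_reprK -raddfD !colim_scaleE.
by rewrite scalerDr raddfD.
Qed.
Fact colim_scaleDl x : {morph colim_scale^~ x : a b / a + b}.
Proof. by move=> a b; rewrite -[x]colim_reprK !colim_scaleE scalerDl raddfD. Qed.

HB.instance Definition _ := GRing.Zmodule_isLmodule.Build K colim
  colim_scaleA colim_scale1 colim_scaleDr colim_scaleDl.

Definition colim_in i (x : M i) : colim := colim_pi (single x).

Fact colim_in_is_linear i : linear (@colim_in i).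
Proof.
move=> a x y; rewrite /colim_in.
have -> : a *: colim_pi (single x) = colim_pi (a *: single x) by exact: colim_scaleE.
rewrite -raddfD; congr colim_pi; apply: val_inj; apply/functional_extensionality_dep => j /=.
rewrite -[RHS]/(a *: single_fun x j + single_fun y j) /single_fun.
case: pselect => [e|_]; last by rewrite scaler0 addr0.
by case: j / e.
Qed.

HB.instance Definition _ i := GRing.isLinear.Build K (M i) colim _ (@colim_in i)
  (@colim_in_is_linear i).

Lemma colim_inB i : zmod_morphism (@colim_in i).
Proof. exact: raddfB. Qed.

Lemma colim_ind (P : colim -> Prop) : P 0 -> (forall x y, P x -> P y -> P (x + y)) ->
  (forall i (x : M i), P (colim_in x)) -> forall x, P x.
Proof.
move=> P0 PD Pin x; rewrite -[x]colim_reprK; move: {x}(colim_repr x) => x.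
have /asboolP/(finite_seqP (_ : set {classic I}))[r rE] := valP x.
have {rE} : forall i : I, dsum_val x i <> 0 -> (i : {classic I}) \in r.
  by move=> i xi; have : [set` r] (i : {classic I}) by rewrite -rE.
elim: r x => [|k r IH] x xr.
  rewrite (_ : x = 0) ?raddf0//; apply: val_inj; apply/functional_extensionality_dep => i.
  by apply/eqP/negP => /negP/eqP/xr.
rewrite -[x](subrK (single (dsum_val x k))) raddfD; apply: PD; last exact: Pin.
apply: IH => i; rewrite -[X in X <> 0]/(dsum_val x i - single_fun (dsum_val x k) i).
rewrite /single_fun; case: pselect => [e|ki]; first by case: i / e; rewrite subrr.
by rewrite subr0 => /xr; rewrite inE => /predU1P[ik|//]; case: ki.
Qed.

Section Lift.
Variables (N : lmodType K) (g : forall i, {linear M i -> N}).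

Definition dsum_lift (x : dsum) : N := \sum_(i \in [set: {classic I}]) g i (dsum_val x i).

Lemma dsum_lift_seq (x : dsum) (r : seq {classic I}) : uniq r ->
  (forall i : I, dsum_val x i <> 0 -> (i : {classic I}) \in r) ->
  dsum_lift x = \sum_(i <- r) g i (dsum_val x i).
Proof.
move=> ur xr; rewrite /dsum_lift (@fsbigE _ _ _ _ _ r _ ur)//; first by rewrite big_mkcond; apply: eq_bigr => i _; rewrite in_setT.
move=> i _ ir; have [->|/eqP/xr] := eqVneq (dsum_val x i) 0; first exact: raddf0.
by rewrite (negPf ir).
Qed.

Lemma dsum_supp (x : dsum) : exists r : seq {classic I},
  forall i : I, dsum_val x i <> 0 -> (i : {classic I}) \in r.
Proof.
have /asboolP/(finite_seqP (_ : set {classic I}))[r rE] := valP x.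
by exists r => i xi; have : [set` r] (i : {classic I}) by rewrite -rE.
Qed.

Lemma dsum_lift_is_linear : linear dsum_lift.
Proof.
move=> a x y; have [r xr] := dsum_supp x; have [t yt] := dsum_supp y.
have h z (zr : forall i : I, dsum_val z i <> 0 -> (i : {classic I}) \in r ++ t) :=
  @dsum_lift_seq z (undup (r ++ t)) (undup_uniq _) (fun i zi => etrans (mem_undup _ _) (zr i zi)).
rewrite !h.
- rewrite scaler_sumr -big_split; apply: eq_bigr => i _ /=.
  by rewrite -linearP.
- by move=> i /yt it; rewrite mem_cat it orbT.
- by move=> i /xr ir; rewrite mem_cat ir.
move=> i xyi; rewrite mem_cat; have [/xr->//|/contrapT x0] := pselect (dsum_val x i <> 0).
apply/orP; right; apply: yt => y0; apply: xyi.
by rewrite -[LHS]/(a *: dsum_val x i + dsum_val y i) x0 y0 scaler0 addr0.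
Qed.

HB.instance Definition _ := GRing.isLinear.Build K dsum N _ dsum_lift dsum_lift_is_linear.

Lemma dsum_lift_single i (x : M i) : dsum_lift (single x) = g i x.
Proof.
rewrite (@dsum_lift_seq _ [:: i : {classic I}])//.
  rewrite big_seq1 /= /single_fun; case: pselect => // e.
  by rewrite (Prop_irrelevance e erefl).
by move=> j /=; rewrite /single_fun inE; case: pselect => // e _; apply/eqP; rewrite e.
Qed.

Lemma colim_null_lift (A : {pred N}) : submod_closed A ->
  (forall i j (u : hom i j) x, g i x - g j (f u x) \in A) ->
  forall i (x : M i), colim_in x = 0 -> g i x \in A.
Proof.
move=> [A0 AS] Af i x /eqP.
rewrite -[0](raddf0 colim_pi) colim_piE subr0 => /asboolP.
move=> /(_ [pred z | dsum_lift z \in A]); rewrite inE dsum_lift_single; apply.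
  by split=> [|a y z]; rewrite ?inE ?raddf0// !unfold_in /= linearP => *; apply: AS.
move=> _ [j [k [u [y ->]]]] /=.
by rewrite unfold_in /= raddfB /= !dsum_lift_single.
Qed.

End Lift.

End Colimit.

Arguments colim {K I hom M} f.
Arguments colim_in {K I hom M} f i x.
Section TropicalCurve.
Variable R : realType.

Definition curve_variation (T : metricType R) (g : R -> T) (s : seq R) : R :=
  let F := g \o nth 1 (0 :: s) in
  \sum_(0 <= n < size s) mdist (F n) (F n.+1).

Definition curve_length (T : metricType R) (g : R -> T) : \bar R :=
  ereal_sup [set (curve_variation g s)%:E | s in itv_partition 0 1].

Definition is_path_metric (T : metricType R) : Prop := forall x y : T,
  (mdist x y)%:E = ereal_inf [set curve_length g | g in
    [set g : R -> T | {within `[0, 1], continuous g} /\ g 0 = x /\ g 1 = y]].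

(* The star of valence n and radius r consists of n copies of [0, r[ glued at 0;
   f i is the restriction of the isometry to the i-th copy. *)
Definition has_star_nbhd (T : metricType R) (p : T) : Prop :=
  exists (n : nat) (r : R) (f : 'I_n -> R -> T),
    [/\ (0 < n)%N, 0 < r, forall i, f i 0 = p,
        forall i j s t, s \in `[0, r[ -> t \in `[0, r[ ->
          mdist (f i s) (f j t) = if i == j then `|s - t| else s + t &
        nbhs p (\bigcup_i [set f i s | s in `[0, r[])].

Record tropicalCurve := TropicalCurve {
  tc_space :> metricType R;
  tc_compact : compact [set: tc_space];
  tc_connected : connected [set: tc_space];
  tc_path_metric : is_path_metric tc_space;
  tc_star : forall p : tc_space, has_star_nbhd p
}.

(* The vertex and edge sets are initial segments of nat, so that the weighted
   graphs form a small type over which colimits can be taken; every finite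
   weighted graph is isomorphic to one of these. *)
Record wgraph := WGraph {
  nvertex : nat;
  nedge : nat;
  elen : 'I_nedge -> R;
  etail : 'I_nedge -> 'I_nvertex;
  ehead : 'I_nedge -> 'I_nvertex;
  elen_gt0 : forall e, 0 < elen e;
  nvertex_gt0 : (0 < nvertex)%N;
  wgraph_connected : forall x y, connect (fun x y =>
    [exists e, (etail e == x) && (ehead e == y) || (etail e == y) && (ehead e == x)]) x y
}.

Definition vertex (G : wgraph) : finType := 'I_(nvertex G).
Definition edge (G : wgraph) : finType := 'I_(nedge G).

End TropicalCurve.

Arguments elen {R w} e.
Arguments etail {R w} e.
Arguments ehead {R w} e.

Section Forms.
Variables (R : realType) (G : wgraph R).

Definition chains (A : Type) := {ffun edge G -> A}.

Definition dstar (A : zmodType) (alpha : chains A) : {ffun vertex G -> A} :=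
  [ffun x => \sum_(e | ehead e == x) alpha e - \sum_(e | etail e == x) alpha e].

(* H_1(G, A) *)
Definition H1 (A : zmodType) : set (chains A) := [set alpha | dstar alpha = 0].

Definition ext_scalars (alpha : chains int) : chains R := [ffun e => (alpha e)%:~R].

(* The 1-form \sum_e w e * de is encoded by its coefficient family w. *)
Definition forms := {ffun edge G -> R^o}.

Definition harmonic : {pred forms} := [pred w : forms |
  [forall x, \sum_(e | ehead e == x) w e == \sum_(e | etail e == x) w e]].

Fact harmonic_closed : submod_closed harmonic.
Proof.
split=> [|a u v /forallP hu /forallP hv]; apply/forallP => x.
  by rewrite !big1// => e _; rewrite ffunE.
have E (P : pred (edge G)) : \sum_(e | P e) (a *: u + v) e =
    a *: \sum_(e | P e) u e + \sum_(e | P e) v e :> R^o.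
  by rewrite scaler_sumr -big_split; apply: eq_bigr => e _; rewrite !ffunE.
by rewrite !E (eqP (hu x)) (eqP (hv x)).
Qed.

HB.instance Definition _ := GRing.isSubmodClosed.Build R forms harmonic harmonic_closed.

Record Omega : Type := MkOmega { Omega_val :> {ffun edge G -> R^o}; _ : Omega_val \in harmonic }.

HB.instance Definition _ := [isSub for Omega_val].
HB.instance Definition _ := [Choice of Omega by <:].
HB.instance Definition _ := [SubChoice_isSubLmodule of Omega by <:].

(* The bilinear pairing with \int_e' de = elen e if e = e' and 0 otherwise. *)
Definition integral_form (alpha : chains R) (w : forms) : R :=
  \sum_e alpha e * w e * elen e.

End Forms.

Section Dual.
Variables (R : realType) (U : lmodType R).

Definition is_linear_form : {pred U -> R^o} := [pred l : U -> R^o | `[< linear l >]].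

Fact is_linear_form_closed : submod_closed is_linear_form.
Proof.
split=> [|a l m /asboolP hl /asboolP hm]; apply/asboolP => b u v.
  by rewrite scaler0 addr0.
rewrite -[LHS]/(a *: l (b *: u + v) + m (b *: u + v)) hl hm.
rewrite -[RHS]/(b *: (a *: l u + m u) + (a *: l v + m v)).
by rewrite !scalerDr !scalerA (mulrC b a) !addrA; congr (_ + _); rewrite addrAC.
Qed.

HB.instance Definition _ :=
  GRing.isSubmodClosed.Build R (U -> R^o) is_linear_form is_linear_form_closed.

Record dual : Type := Dual { dual_val :> U -> R^o; _ : dual_val \in is_linear_form }.

HB.instance Definition _ := [isSub for dual_val].
HB.instance Definition _ := [Choice of dual by <:].
HB.instance Definition _ := [SubChoice_isSubLmodule of dual by <:].

End Dual.

Section DualMap.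
Variables (R : realType) (U V : lmodType R) (h : {linear U -> V}).

Fact pullback_subproof (l : dual V) : (fun u => l (h u)) \in is_linear_form (U:=U).
Proof.
by apply/asboolP => a u v; rewrite linearP; case: l => l /= /asboolP ->.
Qed.

Definition pullback (l : dual V) : dual U := Dual (pullback_subproof l).

End DualMap.

Section Jacobian.
Variables (R : realType) (G : wgraph R).

Fact integral_subproof (alpha : chains G R) :
  (fun w : Omega G => integral_form alpha w : R^o) \in is_linear_form (U:=Omega G).
Proof.
apply/asboolP => a u v; rewrite /integral_form scaler_sumr -big_split.
apply: eq_bigr => e _; rewrite /= !ffunE.
rewrite mulrDr mulrDl; congr (_ + _).
by rewrite -[RHS]/(a * (alpha e * (u : Omega G) e * elen e)) -[a *: _]/(a * (u : Omega G) e) !mulrA (mulrC a).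
Qed.

Definition integral (alpha : chains G R) : dual (Omega G) := Dual (integral_subproof alpha).

Fact integral_is_additive : zmod_morphism integral.
Proof.
move=> a b; apply: val_inj; apply/funext => w /=.
rewrite -[RHS]/(integral_form a w - integral_form b w) /integral_form -sumrB.
by apply: eq_bigr => e _; rewrite !ffunE mulrBl mulrBl.
Qed.

HB.instance Definition _ :=
  GRing.isZmodMorphism.Build (chains G R) (dual (Omega G)) integral integral_is_additive.

Definition integralZ (alpha : chains G int) : dual (Omega G) := integral (ext_scalars alpha).

Fact integralZ_is_additive : zmod_morphism integralZ.
Proof.
move=> a b; rewrite /integralZ -raddfB; congr integral.
by apply/ffunP => e; rewrite !ffunE rmorphB.
Qed.

HB.instance Definition _ :=
  GRing.isZmodMorphism.Build (chains G int) (dual (Omega G)) integralZ integralZ_is_additive.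

(* Omega(G)^# as a subgroup of the dual of Omega(G) *)
Definition in_sharp : {pred dual (Omega G)} :=
  [pred l : dual (Omega G) | `[< exists alpha, l = integralZ alpha >]].

Fact in_sharp_closed : zmod_closed in_sharp.
Proof.
split=> [|_ _ /asboolP[a ->] /asboolP[b ->]]; apply/asboolP.
  by exists 0; rewrite raddf0.
by exists (a - b); rewrite raddfB.
Qed.

HB.instance Definition _ :=
  GRing.isZmodClosed.Build (dual (Omega G)) in_sharp in_sharp_closed.

Record sharp : Type := Sharp { sharp_val :> dual (Omega G); _ : sharp_val \in in_sharp }.

HB.instance Definition _ := [isSub for sharp_val].
HB.instance Definition _ := [Choice of sharp by <:].
HB.instance Definition _ := [SubChoice_isSubZmodule of sharp by <:].

(* the image of H_1(G, Z) in Omega(G)^# *)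
Definition sharp_H1 : {pred sharp} := [pred l : sharp |
  `[< exists2 alpha, H1 alpha & (l : dual (Omega G)) = integralZ alpha >]].

Lemma dstarB (A : zmodType) (a b : chains G A) : dstar (a - b) = dstar a - dstar b.
Proof.
apply/ffunP => x; rewrite !ffunE.
have S (P : pred (edge G)) :
    \sum_(e | P e) (a - b) e = \sum_(e | P e) a e - \sum_(e | P e) b e.
  by rewrite -sumrB; apply: eq_bigr => e _; rewrite !ffunE.
by rewrite !S !opprD addrACA.
Qed.

Fact H1_closed (A : zmodType) : H1 (0 : chains G A) /\
  forall a b : chains G A, H1 a -> H1 b -> H1 (a - b).
Proof.
rewrite /H1; split=> [|a b] /=; last by move=> ha hb; rewrite dstarB ha hb subrr.
by rewrite -[0 in LHS](subrr 0) dstarB subrr.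
Qed.

Fact sharp_H1_closed : zmod_closed sharp_H1.
Proof.
split=> [|u v /asboolP[a ha ua] /asboolP[b hb vb]]; apply/asboolP.
  by exists 0; [exact: (H1_closed int).1|rewrite !raddf0].
by exists (a - b); [exact: (H1_closed int).2|rewrite !raddfB /= ua vb].
Qed.

HB.instance Definition _ := GRing.isZmodClosed.Build sharp sharp_H1 sharp_H1_closed.

Definition jac : Type := Quotient.quot sharp_H1.
HB.instance Definition _ := GRing.Zmodule.on jac.

Fact jac_class_subproof (alpha : chains G int) : integralZ alpha \in in_sharp.
Proof. by apply/asboolP; exists alpha. Qed.

Definition jac_class (alpha : chains G int) : jac :=
  \pi_(Quotient.quot sharp_H1)%qT (Sharp (jac_class_subproof alpha)).

End Jacobian.
Section Subdivision.
Variable R : realType.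

(* s is an oriented edge path from x to y *)
Fixpoint walk (G : wgraph R) (x : vertex G) (s : seq (edge G)) (y : vertex G) : bool :=
  if s is e :: s' then (etail e == x) && walk (ehead e) s' y else x == y.

Record subdivision (G1 G2 : wgraph R) := Subdivision {
  sub_vertex : vertex G1 -> vertex G2;
  sub_edge : edge G1 -> seq (edge G2);
  sub_walk : forall e,
    walk (sub_vertex (etail e)) (sub_edge e) (sub_vertex (ehead e));
  sub_elen : forall e, \sum_(e' <- sub_edge e) elen e' = elen e;
  sub_edges : perm_eq (flatten [seq sub_edge e | e <- enum (edge G1)]) (enum (edge G2));
  (* the vertices of G2 are those of G1 and the new vertices interior to the
     subdivided edges, without repetition *)
  sub_vertices : perm_eq
    ([seq sub_vertex x | x <- enum (vertex G1)] ++
     flatten [seq [seq etail e' | e' <- behead (sub_edge e)] | e <- enum (edge G1)])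
    (enum (vertex G2))
}.

End Subdivision.

Section Push.
Variables (R : realType) (G1 G2 : wgraph R) (s : subdivision G1 G2).

(* The linear extension of e |-> \sum_i e_i (the sum has exactly one term, since
   e' lies on exactly one edge of G1). *)
Definition push (A : zmodType) (alpha : chains G1 A) : chains G2 A :=
  [ffun e' => \sum_(e | e' \in sub_edge s e) alpha e].

(* The inverse of push on cycles and on harmonic forms, which are constant along
   a subdivided edge: the value of beta on the first piece of e. *)
Definition pull (A : zmodType) (beta : chains G2 A) : chains G1 A :=
  [ffun e => nth 0 [seq beta e' | e' <- sub_edge s e] 0].

Lemma sum_sub (A : zmodType) (F : edge G2 -> A) :
  \sum_e' F e' = \sum_e \sum_(e' <- sub_edge s e) F e'.
Proof.
transitivity (\sum_(e' <- enum (edge G2)) F e'); first by rewrite big_enum.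
by rewrite -(perm_big _ (sub_edges s)) big_flatten big_map big_enum.
Qed.

Lemma sub_edge_inj e e1 e2 :
  e \in sub_edge s e1 -> e \in sub_edge s e2 -> e1 = e2.
Proof.
move=> h1 h2; apply/eqP/negP => /negP ne.
have : (\sum_f \sum_(e' <- sub_edge s f) (e' == e : nat) = 1)%N.
  transitivity (\sum_(e' <- enum (edge G2)) (e' == e : nat))%N.
    by rewrite -(perm_big _ (sub_edges s)) big_flatten big_map big_enum.
  by rewrite big_enum /= (bigD1 e)//= eqxx big1// => i /negPf->.
have P f : e \in sub_edge s f -> (0 < \sum_(e' <- sub_edge s f) (e' == e : nat))%N.
  by move=> h; rewrite (big_rem e)//= eqxx.
rewrite (bigD1 e1)//= (bigD1 e2) 1?eq_sym//=.
move=> E; suff : (2 <= 1)%N by [].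
by rewrite -[X in (_ <= X)%N]E addnA (leq_trans (leq_add (P _ h1) (P _ h2)) (leq_addr _ _)).
Qed.

Lemma push_sub (A : zmodType) (alpha : chains G1 A) e e' :
  e' \in sub_edge s e -> push alpha e' = alpha e.
Proof.
move=> h; rewrite ffunE (bigD1 e)//= big1 ?addr0// => f /andP[hf /eqP[]].
exact: sub_edge_inj hf h.
Qed.

Fact push_is_additive (A : zmodType) : zmod_morphism (@push A).
Proof.
by move=> a b; apply/ffunP => e; rewrite !ffunE -sumrB; apply: eq_bigr => f _; rewrite !ffunE.
Qed.

HB.instance Definition _ (A : zmodType) :=
  GRing.isZmodMorphism.Build (chains G1 A) (chains G2 A) (@push A) (@push_is_additive A).

Lemma dstarE (G : wgraph R) (A : zmodType) (b : chains G A) x :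
  dstar b x = \sum_e (b e *+ (ehead e == x) - b e *+ (etail e == x)).
Proof.
by rewrite ffunE sumrB; congr (_ - _); rewrite big_mkcond; apply: eq_bigr => e _; case: eqP.
Qed.

Lemma walk_sum (G : wgraph R) (A : zmodType) (c : A) x a t b : @walk R G a t b ->
  \sum_(e <- t) (c *+ (ehead e == x) - c *+ (etail e == x)) =
  c *+ (b == x) - c *+ (a == x).
Proof.
elim: t a => [a /eqP->|e t IH a /= /andP[/eqP<- /IH h]]; first by rewrite big_nil subrr.
by rewrite big_cons h addrC addrA subrK.
Qed.

Lemma dstar_push (A : zmodType) (a : chains G1 A) x : dstar (push a) x =
  \sum_e (a e *+ (sub_vertex s (ehead e) == x) - a e *+ (sub_vertex s (etail e) == x)).
Proof.
rewrite dstarE sum_sub; apply: eq_bigr => e _.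
rewrite -(walk_sum _ _ (sub_walk s e)); apply: eq_big_seq => e' he'.
by rewrite (push_sub _ he').
Qed.

Lemma vertices_uniq : uniq ([seq sub_vertex s x | x <- enum (vertex G1)] ++
     flatten [seq [seq etail e' | e' <- behead (sub_edge s e)] | e <- enum (edge G1)]).
Proof. by rewrite (perm_uniq (sub_vertices s)) enum_uniq. Qed.

Lemma sub_vertex_inj : injective (sub_vertex s).
Proof.
have := vertices_uniq; rewrite cat_uniq => /andP[/injectiveP].
by move=> h _; exact: h.
Qed.

Lemma dstar_push_old (A : zmodType) (a : chains G1 A) y :
  dstar (push a) (sub_vertex s y) = dstar a y.
Proof.
by rewrite dstar_push dstarE; apply: eq_bigr => e _; rewrite !(inj_eq sub_vertex_inj).
Qed.

Lemma dstar_push_new (A : zmodType) (a : chains G1 A) x :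
  (forall y, sub_vertex s y != x) -> dstar (push a) x = 0.
Proof.
by move=> h; rewrite dstar_push big1// => e _; rewrite !(negPf (h _)) subrr.
Qed.

Lemma push_H1 (A : zmodType) (a : chains G1 A) : H1 a -> H1 (push a).
Proof.
rewrite /H1 /= => h; apply/ffunP => x; rewrite [RHS]ffunE.
have [y /eqP<-|n] := pickP (fun y => sub_vertex s y == x).
  by rewrite dstar_push_old h ffunE.
by apply: dstar_push_new => y; rewrite n.
Qed.

Lemma walk_sum_new (G : wgraph R) (A : zmodType) (b : chains G A) x e t y :
  walk (ehead e) t y -> y != x ->
  \sum_(f <- e :: t) (b f *+ (ehead f == x) - b f *+ (etail f == x)) =
  - b e *+ (etail e == x) +
  \sum_(p <- zip (e :: t) t) (b p.1 - b p.2) *+ (etail p.2 == x).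
Proof.
elim: t e => [|f t IH] e /=.
  move=> /eqP<- /negPf yx; rewrite big_seq1 big_nil yx mulr0n sub0r addr0.
  by rewrite mulNrn.
move=> /andP[/eqP fe w] yx; rewrite big_cons (IH _ w yx) big_cons /= fe.
rewrite addrA [RHS]addrA; congr (_ + _).
by rewrite mulrnBl !mulNrn (addrC (b e *+ _)) addrA.
Qed.

Lemma sub_cons e : exists f t, sub_edge s e = f :: t.
Proof.
case E : (sub_edge s e) => [|f t]; last by exists f, t.
by have := elen_gt0 e; rewrite -(sub_elen s) E big_nil ltxx.
Qed.

Lemma sum_uniq (A : zmodType) (T : eqType) (V : eqType) (L : seq T) (f : T -> V)
    (F : T -> A) z :
  uniq (map f L) -> z \in L -> \sum_(w <- L) F w *+ (f w == f z) = F z.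
Proof.
elim: L => //= a L IH /andP[/negP na u]; rewrite inE => /predU1P[->|zL].
  rewrite big_cons eqxx big_seq big1 ?addr0// => w wL; case: eqP => // e.
  by case: na; rewrite -e map_f.
rewrite big_cons IH// (_ : (f a == f z) = false) ?mulr0n ?add0r//.
by apply/eqP => e; case: na; rewrite e map_f.
Qed.

Lemma H1_consec (A : zmodType) (b : chains G2 A) e p : H1 b ->
  p \in zip (sub_edge s e) (behead (sub_edge s e)) -> b p.1 = b p.2.
Proof.
pose L := flatten [seq zip (sub_edge s f) (behead (sub_edge s f)) | f <- enum (edge G1)].
have LE : map (fun w => etail w.2) L =
    flatten [seq [seq etail e' | e' <- behead (sub_edge s f)] | f <- enum (edge G1)].
  rewrite /L map_flatten -map_comp; congr flatten; apply: eq_map => f /=.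
  rewrite -[in RHS](@unzip2_zip _ _ (sub_edge s f) (behead (sub_edge s f))).
    by rewrite /unzip2 -map_comp.
  by rewrite size_behead leq_pred.
move=> hb pz; have pL : p \in L.
  apply/flattenP; exists (zip (sub_edge s e) (behead (sub_edge s e))) => //.
  by apply: (map_f (fun f => zip (sub_edge s f) (behead (sub_edge s f)))); rewrite mem_enum.
have := vertices_uniq; rewrite -LE cat_uniq => /and3P[_ /hasPn hn uL].
have new y : sub_vertex s y != etail p.2.
  apply/eqP => yE; have /hn/negP[] : etail p.2 \in [seq etail w.2 | w <- L].
    exact: (map_f (fun w => etail w.2) pL).
  by rewrite -yE; apply: map_f; rewrite mem_enum.
have : dstar b (etail p.2) = 0 by rewrite hb ffunE.
rewrite dstarE sum_sub.
under eq_bigr => f _.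
  have [g [t E]] := sub_cons f; have := sub_walk s f; rewrite E /= => /andP[/eqP gE w].
  rewrite (walk_sum_new _ w (new _)) gE (negPf (new _)) mulr0n add0r.
  rewrite -[X in zip X t]E -[t in zip _ t]/(behead (g :: t)) -E.
  over.
rewrite -[LHS]big_enum -(big_map (fun f => zip (sub_edge s f) (behead (sub_edge s f))) xpredT
   (fun l => \sum_(w <- l) (b w.1 - b w.2) *+ (etail w.2 == etail p.2))) -big_flatten.
rewrite (sum_uniq (fun w => b w.1 - b w.2) uL pL).
by move/eqP; rewrite subr_eq0 => /eqP.
Qed.

Lemma consec_const (T : eqType) (A : Type) (b : T -> A) e t :
  (forall p, p \in zip (e :: t) t -> b p.1 = b p.2) -> forall f, f \in e :: t -> b f = b e.
Proof.
elim: t e => [|g t IH] e h f; first by rewrite inE => /eqP->.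
have eg : b e = b g by exact: (h (e, g) (mem_head _ _)).
rewrite inE => /predU1P[->//|fg]; rewrite eg; apply: IH fg => p pz.
by apply: h; rewrite /= inE pz orbT.
Qed.

Lemma pull_sub (A : zmodType) (b : chains G2 A) e f : H1 b ->
  f \in sub_edge s e -> b f = pull b e.
Proof.
move=> hb; rewrite ffunE; have := fun p => @H1_consec A b e p hb.
by have [g [t ->]] := sub_cons e; move=> h fe; exact: consec_const h _ fe.
Qed.

Lemma pushK (A : zmodType) : cancel (@push A) (@pull A).
Proof.
move=> a; apply/ffunP => e; rewrite ffunE; have [g [t E]] := sub_cons e.
by rewrite E /= (@push_sub _ _ e)// E mem_head.
Qed.

Lemma pullK (A : zmodType) (b : chains G2 A) : H1 b -> push (pull b) = b.
Proof.
move=> hb; apply/ffunP => f.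
have : f \in flatten [seq sub_edge s e | e <- enum (edge G1)].
  by rewrite (perm_mem (sub_edges s)) mem_enum.
move=> /flattenP[_ /mapP[e _ ->] fe].
by rewrite (push_sub _ fe) -(pull_sub hb fe).
Qed.

Lemma pull_H1 (A : zmodType) (b : chains G2 A) : H1 b -> H1 (pull b).
Proof.
by move=> hb; apply/ffunP => y; rewrite -dstar_push_old pullK// hb !ffunE.
Qed.

End Push.
Lemma harmonicP (R : realType) (G : wgraph R) (w : forms G) :
  reflect (H1 (w : chains G R^o)) (w \in harmonic (G:=G)).
Proof.
apply: (iffP forallP) => [h|h x].
  by apply/ffunP => x; rewrite !ffunE (eqP (h x)) subrr.
by have /ffunP/(_ x)/eqP := h; rewrite !ffunE subr_eq0.
Qed.

Section Transition.
Variables (R : realType) (G1 G2 : wgraph R) (s : subdivision G1 G2).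

Fact Omega_push_subproof (w : Omega G1) : push s (w : chains G1 R^o) \in harmonic (G:=G2).
Proof. by apply/harmonicP/push_H1/harmonicP; case: w. Qed.

Definition Omega_push (w : Omega G1) : Omega G2 := MkOmega (Omega_push_subproof w).

Fact Omega_push_is_linear : linear Omega_push.
Proof.
move=> a u v; apply: val_inj; apply/ffunP => e; rewrite /= !ffunE /=.
rewrite scaler_sumr -big_split; apply: eq_bigr => f _ /=; by rewrite !ffunE.
Qed.

HB.instance Definition _ :=
  GRing.isLinear.Build R (Omega G1) (Omega G2) _ Omega_push Omega_push_is_linear.

Fact Omega_pull_subproof (w : Omega G2) : pull s (w : chains G2 R^o) \in harmonic (G:=G1).
Proof. by apply/harmonicP/pull_H1/harmonicP; case: w. Qed.

Definition Omega_pull (w : Omega G2) : Omega G1 := MkOmega (Omega_pull_subproof w).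

Lemma Omega_pushK : cancel Omega_push Omega_pull.
Proof. by move=> w; apply: val_inj; apply: pushK. Qed.

Lemma Omega_pullK : cancel Omega_pull Omega_push.
Proof. by move=> w; apply: val_inj; apply: pullK; apply/harmonicP; case: w. Qed.

Lemma integral_push (a : chains G1 R) (w : Omega G1) :
  integral (push s a) (Omega_push w) = integral a w.
Proof.
rewrite /= /integral_form (sum_sub s); apply: eq_bigr => e _.
rewrite -(sub_elen s) mulr_sumr; apply: eq_big_seq => f fe.
by rewrite (push_sub _ fe) (push_sub (w : chains G1 R^o) fe).
Qed.

Lemma integralZ_push (a : chains G1 int) (w : Omega G1) :
  integralZ (push s a) (Omega_push w) = integralZ a w.
Proof.
rewrite /integralZ -integral_push; congr (integral _ _).
by apply/ffunP => e; rewrite !ffunE rmorph_sum; apply: eq_bigr => f _; rewrite ffunE.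
Qed.

Lemma integralZ_pull (a : chains G1 int) (w : Omega G2) :
  integralZ (push s a) w = integralZ a (Omega_pull w).
Proof. by rewrite -integralZ_push Omega_pullK. Qed.

End Transition.

Section JacobianTransition.
Variables (R : realType).

Lemma jac_class_surj (G : wgraph R) (x : jac G) : exists a, jac_class a = x.
Proof.
have [a E] : exists a, (repr (x : Quotient.quot (sharp_H1 (G:=G))) : dual _) = integralZ a.
  by case: (repr _) => l /= /asboolP.
exists a; rewrite /jac_class -[RHS](@reprK _ (Quotient.quot (sharp_H1 (G:=G))) x).
by congr (\pi_(Quotient.quot _)%qT _); apply: val_inj; rewrite /= -E.
Qed.

Lemma jac_classP (G : wgraph R) (a b : chains G int) :
  jac_class a = jac_class b <-> exists2 h, H1 h & integralZ (a - b) = integralZ h.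
Proof.
have -> : (jac_class a = jac_class b) <->
    (Sharp (jac_class_subproof a) - Sharp (jac_class_subproof b)) \in sharp_H1 (G:=G).
  by rewrite Quotient.idealrBE; split => /eqP.
rewrite raddfB; split=> [/asboolP[h hh E]|[h hh E]]; last apply/asboolP.
  by exists h => //; rewrite -E.
by exists h => //; rewrite -E.
Qed.

Fact jac_class_is_additive (G : wgraph R) : zmod_morphism (@jac_class R G).
Proof.
move=> a b; rewrite /jac_class.
rewrite -(raddfB (\pi_(Quotient.quot (sharp_H1 (G:=G)))%qT)).
by congr (\pi_(Quotient.quot _)%qT _); apply: val_inj; rewrite /= raddfB.
Qed.

HB.instance Definition _ (G : wgraph R) := GRing.isZmodMorphism.Build (chains G int) (jac G)
  (@jac_class R G) (@jac_class_is_additive G).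

Definition jac_repr (G : wgraph R) (x : jac G) : chains G int :=
  projT1 (cid (jac_class_surj x)).

Lemma jac_reprK (G : wgraph R) : cancel (@jac_repr G) (@jac_class R G).
Proof. by move=> x; rewrite /jac_repr; case: cid. Qed.

Variables (G1 G2 : wgraph R) (s : subdivision G1 G2).

(* The class of \int_alpha is sent to that of \int_(r alpha): jac_trans_class
   shows that this does not depend on the representative. *)
Definition jac_trans (x : jac G1) : jac G2 := jac_class (push s (jac_repr x)).

Lemma jac_trans_class a : jac_trans (jac_class a) = jac_class (push s a).
Proof.
have /jac_classP[h hh E] : jac_class (jac_repr (jac_class a)) = jac_class a.
  exact: jac_reprK.
apply/jac_classP; exists (push s h); first exact: push_H1.
apply: val_inj; apply/funext => w; rewrite -raddfB [LHS]integralZ_pull E.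
by rewrite [RHS]integralZ_pull.
Qed.

Fact jac_trans_is_additive : zmod_morphism jac_trans.
Proof.
move=> x y; rewrite -[x]jac_reprK -[y]jac_reprK -raddfB !jac_trans_class.
by rewrite -raddfB -raddfB.
Qed.

HB.instance Definition _ := GRing.isZmodMorphism.Build (jac G1) (jac G2)
  jac_trans jac_trans_is_additive.

End JacobianTransition.

Section Models.
Variables (R : realType) (Gamma : tropicalCurve R).

(* The lengths of the chains joining two points: each step moves along a single
   edge. Their infimum is the metric obtained by gluing the segments
   [0, elen e], that is, the path metric of the geometric realization. *)
Inductive chain_length (G : wgraph R) (phi : edge G -> R -> Gamma) (p : Gamma) :
    Gamma -> R -> Prop :=
| chain_nil : chain_length phi p p 0
| chain_step e s t L : chain_length phi p (phi e s) L ->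
    s \in `[0, elen e] -> t \in `[0, elen e] ->
    chain_length phi p (phi e t) (L + `|s - t|).

(* A model of Gamma is a weighted graph together with an isometry of its
   geometric realization onto Gamma, given by the images of the vertices and by
   one parametrization of each edge (only its values on [0, elen e] matter). *)
Record model := Model {
  model_graph :> wgraph R;
  vmap : vertex model_graph -> Gamma;
  emap : edge model_graph -> R -> Gamma;
  emap_tail : forall e, emap e 0 = vmap (etail e);
  emap_head : forall e, emap e (elen e) = vmap (ehead e);
  vmap_inj : injective vmap;
  emap_inj : forall e e' s t, s \in `]0, elen e[ -> t \in `]0, elen e'[ ->
    emap e s = emap e' t -> e = e' /\ s = t;
  vmap_emap : forall x e t, t \in `]0, elen e[ -> vmap x <> emap e t;
  model_cover : forall p, (exists x, p = vmap x) \/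
    (exists e, exists2 t, t \in `]0, elen e[ & p = emap e t);
  model_isometry : forall p q, mdist p q = inf [set L : R | chain_length emap p q L]
}.

(* A length-preserving subdivision compatible with the identifications of the
   realizations with Gamma. As the realizations are bijective onto Gamma there
   is at most one refinement from G1 to G2 as a map on vertices and edges, so
   the models form a preorder under refinement. *)
Record refinement (G1 G2 : model) := Refinement {
  ref_sub :> subdivision G1 G2;
  ref_vertex : forall x, vmap (sub_vertex ref_sub x) = vmap x;
  ref_edge : forall e s1 e' s2, sub_edge ref_sub e = s1 ++ e' :: s2 ->
    forall t, t \in `[0, elen e'] ->
    emap e' t = emap e (\sum_(f <- s1) elen f + t)
}.

Definition common_refinement (G1 G2 : model) : Prop :=
  exists H : model, inhabited (refinement G1 H) /\ inhabited (refinement G2 H).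

(* R(G0) *)
Record compatible_model (G0 : model) := CompatibleModel {
  compatible_model_model :> model;
  compatible_model_common : common_refinement compatible_model_model G0
}.

Fact sub_refl_vertices (G : wgraph R) : perm_eq
    ([seq x | x <- enum (vertex G)] ++
     flatten [seq [seq etail e' | e' <- behead [:: e]] | e <- enum (edge G)])
    (enum (vertex G)).
Proof.
rewrite map_id (_ : flatten _ = [::]) ?cats0//.
by elim: (enum _).
Qed.

Fact sub_refl_edges (G : wgraph R) :
  perm_eq (flatten [seq [:: e] | e <- enum (edge G)]) (enum (edge G)).
Proof. by rewrite flatten_map1 map_id. Qed.

Fact sub_refl_walk (G : wgraph R) (e : edge G) : walk (etail e) [:: e] (ehead e).
Proof. by rewrite /= !eqxx. Qed.

Fact sub_refl_elen (G : wgraph R) (e : edge G) : \sum_(e' <- [:: e]) elen e' = elen e.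
Proof. by rewrite big_seq1. Qed.

Definition sub_refl (G : wgraph R) : subdivision G G :=
  @Subdivision R G G id (fun e => [:: e]) (@sub_refl_walk G) (@sub_refl_elen G)
    (sub_refl_edges G) (sub_refl_vertices G).

Fact ref_refl_edge (G : model) (e : edge G) s1 e' s2 :
  sub_edge (sub_refl G) e = s1 ++ e' :: s2 ->
  forall t, t \in `[0, elen e'] -> emap e' t = emap e (\sum_(f <- s1) elen f + t).
Proof.
by case: s1 => [|? []]//= [-> _] t _; rewrite big_nil add0r.
Qed.

Definition ref_refl (G : model) : refinement G G :=
  @Refinement G G (sub_refl G) (fun=> erefl) (@ref_refl_edge G).

Lemma common_refinement_refl (G : model) : common_refinement G G.
Proof. by exists G; split; exists; exact: ref_refl. Qed.

Definition base (G0 : model) : compatible_model G0 := CompatibleModel (common_refinement_refl G0).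

End Models.

Section Limits.
Variables (R : realType) (Gamma : tropicalCurve R) (G0 : model Gamma).

Definition OmegaGamma : Type :=
  colim (hom := fun G G' : compatible_model G0 => refinement G G')
    (M := fun G => Omega G) (fun G G' rho => Omega_push rho).

HB.instance Definition _ := GRing.Lmodule.on OmegaGamma.

Definition Omega_in (G : compatible_model G0) : Omega G -> OmegaGamma :=
  colim_in (M := fun G : compatible_model G0 => Omega G)
    (fun G G' (rho : refinement G G') => Omega_push rho) G.

Arguments Omega_in : clear implicits.

HB.instance Definition _ (G : compatible_model G0) := GRing.isLinear.Build R (Omega G) OmegaGamma _
  (Omega_in G) (@colim_in_is_linear _ _ _ _ _ G).

(* The groups J(G) are regarded as modules over int. *)
Definition jac_colim : Type :=
  colim (K := int) (hom := fun G G' : compatible_model G0 => refinement G G')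
    (M := fun G => zmodule (jac G)) (fun G G' rho => jac_trans rho).

HB.instance Definition _ := GRing.Zmodule.on jac_colim.

Definition jac_in (G : compatible_model G0) : jac G -> jac_colim :=
  colim_in (K := int) (M := fun G : compatible_model G0 => zmodule (jac G))
    (fun G G' (rho : refinement G G') => jac_trans rho) G.

Arguments jac_in : clear implicits.

Fact jac_in_is_additive G : zmod_morphism (jac_in G).
Proof.
exact (@colim_inB int _ _ (fun G : compatible_model G0 => zmodule (jac G)) (fun G G' (rho : refinement G G') => jac_trans rho) G).
Qed.

HB.instance Definition _ (G : compatible_model G0) := GRing.isZmodMorphism.Build (jac G) jac_colim
  (jac_in G) (@jac_in_is_additive G).

(* H_1(Gamma, Z) = H_1(G0, Z), embedded by integration in the dual of
   Omega(Gamma) through Omega(G0) ~ Omega(Gamma). *)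
Definition H1Gamma : {pred dual OmegaGamma} := [pred l : dual OmegaGamma |
  `[< exists2 a : chains G0 int, H1 a & pullback (Omega_in (base G0)) l = integralZ a >]].

Fact pullbackB (U V : lmodType R) (h : {linear U -> V}) (l m : dual V) :
  pullback h (l - m) = pullback h l - pullback h m.
Proof. exact: val_inj. Qed.

Fact H1Gamma_closed : zmod_closed H1Gamma.
Proof.
split=> [|u v /asboolP[a ha ua] /asboolP[b hb vb]]; apply/asboolP.
  exists 0; first exact: (H1_closed _ int).1.
  by rewrite raddf0 -[0 in LHS](subrr 0) pullbackB subrr.
exists (a - b); first exact: (H1_closed _ int).2.
by rewrite raddfB pullbackB ua vb.
Qed.

HB.instance Definition _ := GRing.isZmodClosed.Build (dual OmegaGamma) H1Gamma H1Gamma_closed.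

Definition jacGamma : Type := Quotient.quot H1Gamma.
HB.instance Definition _ := GRing.Zmodule.on jacGamma.

Definition jacGamma_class (l : dual OmegaGamma) : jacGamma :=
  \pi_(Quotient.quot H1Gamma)%qT l.

End Limits.

Arguments Omega_in {R Gamma G0} G w.
Arguments jac_in {R Gamma G0} G x.
Arguments H1Gamma {R Gamma} G0.

Section Evaluation.
Variables (R : realType) (Gamma : tropicalCurve R).

Definition on_edge (G : model Gamma) (e : edge G) (p : Gamma) : Prop :=
  exists2 t, t \in `]0, elen e[ & p = emap e t.

(* A form on G as a function on Gamma, with value w e on the interior of e.
   Refining G changes it at finitely many points only. *)
Definition ev (G : model Gamma) (w : Omega G) : Gamma -> R^o :=
  fun p => \sum_(e | `[< on_edge e p >]) w e.

Lemma ev_is_linear (G : model Gamma) : linear (@ev G).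
Proof.
move=> a u v; apply/funext => p.
rewrite -[RHS]/(a *: ev u p + ev v p) /ev scaler_sumr -big_split.
by apply: eq_bigr => e _; rewrite /= !ffunE.
Qed.

HB.instance Definition _ (G : model Gamma) :=
  GRing.isLinear.Build R (Omega G) (Gamma -> R^o) _ (@ev G) (@ev_is_linear G).

Lemma ev_on (G : model Gamma) (w : Omega G) e p : on_edge e p -> ev w p = w e.
Proof.
move=> ep; rewrite /ev (bigD1 e)/=; last exact/asboolP.
rewrite big1 ?addr0// => f /andP[/asboolP[t tf pt] /eqP[]].
by case: ep => u ue pu; apply: (emap_inj tf ue _).1; rewrite -pt.
Qed.

Definition finvanish : {pred Gamma -> R^o} :=
  [pred h : Gamma -> R^o | `[< finite_set [set p | h p <> 0] >]].

Lemma finvanish_closed : submod_closed finvanish.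
Proof.
split=> [|a x y /asboolP fx /asboolP fy]; apply/asboolP.
  by rewrite (_ : [set _ | _] = set0) // -subset0 => i /=.
apply: (@sub_finite_set _ _ ([set i | x i <> 0] `|` [set i | y i <> 0])).
  move=> i /= xy; have [x0|] := pselect (x i = 0); last by left.
  by right=> y0; apply: xy; rewrite -[LHS]/(a *: x i + y i) x0 y0 scaler0 addr0.
by rewrite finite_setU.
Qed.

Lemma ref_on_edge (G1 G2 : model Gamma) (rho : refinement G1 G2) e f p :
  f \in sub_edge rho e -> on_edge f p -> on_edge e p.
Proof.
move=> fe [t tf pt].
have [s1 [s2 E]] : exists s1 s2, sub_edge rho e = s1 ++ f :: s2.
  by case/path.splitPr: fe => s1 s2; exists s1, s2.
move: tf; rewrite in_itv /= => /andP[t0 tf].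
have S0 (s : seq (edge G2)) : 0 <= \sum_(g <- s) elen g.
  by apply: sumr_ge0 => g _; exact/ltW/elen_gt0.
exists (\sum_(g <- s1) elen g + t).
  rewrite in_itv /= ltr_wpDl ?S0//= -(sub_elen rho) E big_cat /= big_cons.
  by rewrite ltrD2l (lt_le_trans tf)// lerDl S0.
by rewrite pt (ref_edge E)// in_itv /= !ltW.
Qed.

Lemma ev_push (G1 G2 : model Gamma) (rho : refinement G1 G2) (w : Omega G1) :
  ev w - ev (Omega_push rho w) \in finvanish.
Proof.
apply/asboolP; apply: (@sub_finite_set _ _ (vmap (m:=G2) @` setT)); last first.
  exact/finite_image/finite_finset.
move=> p /= np; case: (model_cover G2 p) => [[x ->]|[f [t tf pt]]]; first by exists x.
have fp : on_edge f p by exists t.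
have : f \in flatten [seq sub_edge rho e | e <- enum (edge G1)].
  by rewrite (perm_mem (sub_edges rho)) mem_enum.
move=> /flattenP[_ /mapP[e _ ->] fe]; case: np.
rewrite -[LHS]/(ev w p - ev (Omega_push rho w) p).
rewrite (ev_on _ (ref_on_edge fe fp)) (ev_on _ fp) /=.
by rewrite (push_sub (w : chains G1 R^o) fe) subrr.
Qed.

Lemma ev_inj (G : model Gamma) (w : Omega G) : ev w \in finvanish -> w = 0.
Proof.
move=> /asboolP fw; apply: val_inj; apply/ffunP => e; rewrite [RHS]ffunE.
apply: contrapT => we0.
have e0 := elen_gt0 e.
pose h (n : nat) := emap e (elen e / n.+2%:R).
have hI n : elen e / n.+2%:R \in `]0, elen e[.
  rewrite in_itv /= divr_gt0 //= ltr_pdivrMr ?ltr0n// ltr_pMr// ltr1n //.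
apply: infinite_nat; rewrite -(_ : h @^-1` [set p | ev w p <> 0] = setT).
  apply: finite_preimage => // i j _ _ hij.
  have [_] := emap_inj (hI i) (hI j) hij.
  by move/(mulfI (lt0r_neq0 e0))/invr_inj/eqP; rewrite eqr_nat => /eqP[].
rewrite -subTset => n _ /=; rewrite (@ev_on _ _ e) //.
by exists (elen e / n.+2%:R).
Qed.

End Evaluation.

Section Comparison.
Variables (R : realType) (Gamma : tropicalCurve R) (G0 : model Gamma).

Lemma Omega_in_push (G G' : compatible_model G0) (rho : refinement G G') w :
  Omega_in G' (Omega_push rho w) = Omega_in G w.
Proof.
apply/esym/eqP; rewrite /Omega_in /colim_in colim_piE; apply/asboolP => A _; apply.
by exists G, G', rho, w.
Qed.

Lemma compatible_model_refine (G : compatible_model G0) :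
  exists H : compatible_model G0, inhabited (refinement G H) /\ inhabited (refinement (base G0) H).
Proof.
have [H [GH G0H]] := compatible_model_common G.
have HG0 : common_refinement H G0 by exists H; split=> //; exists; exact: ref_refl.
by exists (CompatibleModel HG0).
Qed.

Lemma Omega_in_bij (G : compatible_model G0) : bijective (Omega_in G).
Proof.
rewrite -setTT_bijective; split=> //; last first.
  move=> x _; elim/colim_ind: x => [|x y [u _ <-] [v _ <-]|G' w'].
  - by exists 0 => //; exact: raddf0.
  - by exists (u + v) => //; exact: raddfD.
  have [H' [[r'] [r0']]] := compatible_model_refine G'.
  have [H [[r] [r0]]] := compatible_model_refine G.
  exists (Omega_pull r (Omega_push r0 (Omega_pull r0' (Omega_push r' w')))) => //.
  rewrite -(Omega_in_push r) Omega_pullK (Omega_in_push r0) -(Omega_in_push r0').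
  by rewrite Omega_pullK; exact: Omega_in_push.
apply: in2W => u v uv; apply/eqP; rewrite -subr_eq0; apply/eqP/ev_inj.
pose g (G : compatible_model G0) : {linear Omega G -> Gamma -> R^o} := @ev R Gamma G.
refine (@colim_null_lift R _ _ (fun G : compatible_model G0 => Omega G)
  (fun G G' (rho : refinement G G') => Omega_push rho) _ g _
  (@finvanish_closed R Gamma) _ G (u - v) _).
  by move=> i j rho w; exact: ev_push.
apply: etrans (_ : Omega_in G u - Omega_in G v = 0); last by rewrite uv subrr.
exact: (raddfB (Omega_in G)).
Qed.

Fact Omega_out_subproof (G : compatible_model G0) (x : OmegaGamma G0) :
  exists w, Omega_in G w = x.
Proof. by have [g _ gK] := Omega_in_bij G; exists (g x). Qed.

Definition Omega_out (G : compatible_model G0) (x : OmegaGamma G0) : Omega G :=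
  projT1 (cid (Omega_out_subproof G x)).

Lemma Omega_outK G : cancel (Omega_out G) (Omega_in G).
Proof. by move=> x; rewrite /Omega_out; case: cid. Qed.

Lemma Omega_inK G : cancel (Omega_in G) (Omega_out G).
Proof. by move=> w; apply: (bij_inj (Omega_in_bij G)); rewrite Omega_outK. Qed.

Fact Omega_out_is_linear G : linear (Omega_out G).
Proof.
move=> a x y; apply: (bij_inj (Omega_in_bij G)).
rewrite [LHS]Omega_outK [RHS](linearP (Omega_in G)).
exact: (congr2 (fun u v => a *: u + v) (esym (Omega_outK G x)) (esym (Omega_outK G y))).
Qed.

HB.instance Definition _ (G : compatible_model G0) := GRing.isLinear.Build R (OmegaGamma G0) (Omega G) _
  (Omega_out G) (@Omega_out_is_linear G).

(* The isomorphism of duals inverse to the transpose of Omega_in. *)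
Definition dual_transfer (G : compatible_model G0) : dual (Omega G) -> dual (OmegaGamma G0) :=
  pullback (Omega_out G).

Arguments dual_transfer : clear implicits.

Lemma dual_transfer_H1 (G : compatible_model G0) (h : chains G int) :
  H1 h -> dual_transfer G (integralZ h) \in H1Gamma G0.
Proof.
move=> hh; have [H [[r] [r0]]] := compatible_model_refine G.
have rh : H1 (push r h) by exact: push_H1.
apply/asboolP; exists (pull r0 (push r h)); first exact: pull_H1.
apply: val_inj; apply/funext => w.
rewrite -[LHS]/(integralZ h (Omega_out G (Omega_in (base G0) w))).
rewrite -(Omega_in_push r0) -[X in Omega_in _ X](Omega_pullK r) (Omega_in_push r) Omega_inK.
apply: etrans (integralZ_push r0 _ _).
by rewrite -integralZ_pull pullK.
Qed.

(* J(G) -> Omega(G)^* / H_1(G, Z) ~ Omega(Gamma)^* / H_1(Gamma, Z); see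
   jac_map_class for the independence of the representative. *)
Definition jac_map (G : compatible_model G0) (x : jac G) : jacGamma G0 :=
  jacGamma_class (dual_transfer G (integralZ (jac_repr x))).

Lemma jacGamma_classP (l m : dual (OmegaGamma G0)) :
  jacGamma_class l = jacGamma_class m <-> l - m \in H1Gamma G0.
Proof. by rewrite Quotient.idealrBE; split => /eqP. Qed.

Lemma jac_map_class (G : compatible_model G0) (a : chains G int) :
  jac_map (jac_class a) = jacGamma_class (dual_transfer G (integralZ a)).
Proof.
have /jac_classP[h hh E] : jac_class (jac_repr (jac_class a)) = jac_class a.
  exact: jac_reprK.
apply/jacGamma_classP; rewrite -pullbackB [X in pullback _ X](_ : _ = integralZ h).
  exact: dual_transfer_H1.
by rewrite -E raddfB.
Qed.

Fact jac_map_is_additive (G : compatible_model G0) : zmod_morphism (@jac_map G).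
Proof.
move=> x y; rewrite -[x]jac_reprK -[y]jac_reprK -raddfB !jac_map_class raddfB.
rewrite /dual_transfer pullbackB.
exact: (raddfB (\pi_(Quotient.quot (H1Gamma G0)))%qT).
Qed.

HB.instance Definition _ (G : compatible_model G0) := GRing.isZmodMorphism.Build (jac G)
  (jacGamma G0) (@jac_map G) (@jac_map_is_additive G).

End Comparison.

Arguments dual_transfer {R Gamma G0} G l.
Arguments jac_map {R Gamma G0} G x.

(* Main.v *)
From HB Require Import structures.
Require Import Defs.
From mathcomp Require Import all_boot all_order all_algebra.
From mathcomp Require Import all_classical all_reals all_analysis.
From mathcomp Require Import lra.

(** Each [jac G] maps to the fixed group [jacGamma G0] by integration, and these
    maps agree with the transition maps because refining a model changes neither
    integrals nor cycles; the universal property of the colimit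
    ([colim_lift_in]) turns them into one map. Each of them is injective
    ([jac_map_inj]): cycles on [G0] and on [G] correspond to each other through
    a common refinement, so that the same integrals are divided out on both
    sides.

    Injectivity of the map from the colimit then amounts to every element of the
    colimit coming from a single model, that is, to directedness of the models
    ([compatible_model_directed]). Cutting an edge at an interior point gives a
    model ([cut_model]), so a model can be made to have any finite set of points
    among its vertices. If [H] and [H'] refine [G0] and [K] is [H] cut at the
    vertices of [H'], no edge of [K] can leave an edge of [H'], and [K] refines
    both. Refinements are handled through the relation [finer], which says that
    each edge of one model is a segment of an edge of the other; the lists of
    edges that make up a refinement are recovered at the end, by following each
    edge from its tail to its head ([finer_refinement]).

    For surjectivity, a linear form on the harmonic forms of [G0] extends to all
    1-forms, hence is integration along a real chain ([integral_surj]). By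
    additivity the chain may be taken to be [t] times an edge [e]. The integral
    part of [t] gives an element of [jac G0]. For [0 < t < 1], cutting [e] at the
    fraction [t] of its length gives a first piece along which the integral is
    [t] times that along [e] ([reached_fraction]), so the class comes from the
    model that was cut. *)

Set Implicit Arguments.
Unset Strict Implicit.
Unset Printing Implicit Defensive.

Import Order.TTheory GRing.Theory Num.Theory.

Local Open Scope ring_scope.

(** * Maps out of a colimit *)

Section UniversalProperty.
Variables (K : nzRingType) (I : Type) (hom : I -> I -> Type).
Variables (M : I -> lmodType K) (f : forall i j, hom i j -> M i -> M j).
Variables (N : lmodType K) (g : forall i, {linear M i -> N}).
Hypothesis gf : forall i j (u : hom i j) x, g j (f u x) = g i x.

(** The kernel of the map out of the direct sum is a submodule containing the
    generators of the relations, by compatibility of the cocone. *)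
Lemma dsum_lift_null (z : dsum M) : z \in colim_null f -> dsum_lift g z = 0.
Proof.
move=> /asboolP /(_ [pred z | dsum_lift g z == 0]) h; apply/eqP; apply: h.
  split=> [|a x y]; rewrite !unfold_in /= ?raddf0// => /eqP x0 /eqP y0.
  have -> : dsum_lift g (a *: x + y) = a *: dsum_lift g x + dsum_lift g y.
    exact: linearP.
  by rewrite x0 y0 scaler0 addr0.
move=> _ [i [j [u [x ->]]]] /=.
by rewrite unfold_in /= raddfB /= !dsum_lift_single gf subrr.
Qed.

(** Independent of the chosen representative by [dsum_lift_null]. *)
Definition colim_lift (x : colim f) : N := dsum_lift g (colim_repr x).

Lemma colim_lift_pi z : colim_lift (colim_pi f z) = dsum_lift g z.
Proof.
apply/eqP; rewrite -subr_eq0 -raddfB; apply/eqP/dsum_lift_null.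
by rewrite -colim_piE; apply/eqP; exact: colim_reprK.
Qed.

Lemma colim_lift_in i x : colim_lift (colim_in f i x) = g i x.
Proof. by rewrite colim_lift_pi dsum_lift_single. Qed.

Lemma colim_lift_is_additive : zmod_morphism colim_lift.
Proof.
move=> x y; rewrite -[x](@colim_reprK _ _ _ _ f) -[y](@colim_reprK _ _ _ _ f).
by rewrite -raddfB !colim_lift_pi raddfB.
Qed.

End UniversalProperty.

(** * Refinements as nesting of edges *)

Lemma flatten_uniq (T S : eqType) (F : T -> seq S) (r : seq T) : uniq r ->
  (forall i, uniq (F i)) -> (forall i j x, x \in F i -> x \in F j -> i = j) ->
  uniq (flatten [seq F i | i <- r]).
Proof.
move=> ur uF dF; elim: r ur => //= i r IH /andP[ir ur].
rewrite cat_uniq uF IH// andbT; apply/hasPn => x /flattenP[_ /mapP[j jr ->] xj].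
by apply: contra ir => xi; rewrite (dF _ _ _ xi xj).
Qed.

Section Refinement.
Variables (R : realType) (Gamma : tropicalCurve R).
Implicit Types G K H : model Gamma.

Definition lies_in G K (f : edge K) (e : edge G) (a : R) : Prop :=
  [/\ 0 <= a, a + elen f <= elen e &
      forall t, t \in `[0, elen f] -> emap f t = emap e (a + t)].

(** The geometric content of a refinement, with the combinatorial data dropped: in
    this form transitivity is immediate, whereas composing two subdivisions
    would mean concatenating lists of edges. It also makes the vertices of [G]
    vertices of [K]: inside an edge of [K], they would be inside an edge of [G]. *)
Definition finer G K : Prop :=
  forall f : edge K, exists e : edge G, exists a, lies_in f e a.

Lemma finer_refl G : finer G G.
Proof. by move=> f; exists f, 0; split; rewrite ?add0r// => t _; rewrite add0r. Qed.

Lemma lies_in_trans G H K (f : edge K) (g : edge H) (e : edge G) a b :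
  lies_in f g a -> lies_in g e b -> lies_in f e (b + a).
Proof.
move=> [a0 al fE] [b0 bl gE]; split; [lra|lra|] => t.
rewrite in_itv/= => /andP[t0 tl]; rewrite fE ?in_itv/= ?t0// gE ?addrA//.
by rewrite in_itv/=; apply/andP; split; lra.
Qed.

Lemma finer_trans G H K : finer G H -> finer H K -> finer G K.
Proof.
move=> GH HK f; have [g [a fg]] := HK f; have [e [b ge]] := GH g.
by exists e, (b + a); exact: lies_in_trans fg ge.
Qed.

Lemma refinement_finer G K : refinement G K -> finer G K.
Proof.
move=> rho f.
have : f \in flatten [seq sub_edge rho e | e <- enum (edge G)].
  by rewrite (perm_mem (sub_edges rho)) mem_enum.
move=> /flattenP[_ /mapP[e _ ->] fe].
have [s1 [s2 E]] : exists s1 s2, sub_edge rho e = s1 ++ f :: s2.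
  by case/path.splitPr: fe => s1 s2; exists s1, s2.
have S0 (s : seq (edge K)) : 0 <= \sum_(g <- s) elen g.
  by apply: sumr_ge0 => g _; exact/ltW/elen_gt0.
exists e, (\sum_(g <- s1) elen g); split => [//||]; last exact: (ref_edge E).
by rewrite -(sub_elen rho) E big_cat /= big_cons lerD2l lerDl.
Qed.

(** ** From nested edges to a subdivision *)

Section FinerRefinement.
Variables (G K : model Gamma) (GK : finer G K).

Definition host (f : edge K) : edge G := projT1 (cid (GK f)).
Definition offset (f : edge K) : R := projT1 (cid (projT2 (cid (GK f)))).

Lemma hostP f : lies_in f (host f) (offset f).
Proof. exact: (projT2 (cid (projT2 (cid (GK f))))). Qed.

Lemma lies_in_itv (f : edge K) (e : edge G) a t :
  lies_in f e a -> t \in `]0, elen f[ -> a + t \in `]0, elen e[.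
Proof.
move=> [a0 al _]; rewrite !in_itv/= => /andP[t0 tl]; apply/andP; split; lra.
Qed.

Lemma lies_in_emap (f : edge K) (e : edge G) a t :
  lies_in f e a -> t \in `]0, elen f[ -> emap f t = emap e (a + t).
Proof. by move=> [_ _ h] tI; apply: h; apply: subset_itv_oo_cc. Qed.

Lemma tail_offset f : vmap (etail f) = emap (host f) (offset f).
Proof.
have [_ _ h] := hostP f; rewrite -emap_tail h ?addr0// in_itv/= lexx.
exact/ltW/elen_gt0.
Qed.

Lemma head_offset f : vmap (ehead f) = emap (host f) (offset f + elen f).
Proof.
have [_ _ h] := hostP f; rewrite -emap_head h// in_itv/= lexx andbT.
exact/ltW/elen_gt0.
Qed.

Definition breakpoint (e : edge G) (u : R) := exists y : vertex K, vmap y = emap e u.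

Lemma breakpoint_interior f u : breakpoint (host f) u ->
  ~~ (offset f < u < offset f + elen f).
Proof.
move=> [y yE]; apply/negP => /andP[u0 ul].
have uI : u - offset f \in `]0, elen f[ by rewrite in_itv/=; apply/andP; split; lra.
apply: (@vmap_emap _ _ K y f _ uI).
by rewrite yE (lies_in_emap (hostP f) uI) addrCA subrr addr0.
Qed.

(** [K] covers [Gamma] and its edges run inside edges of [G], whose interiors are
    disjoint and injectively parametrized; so a covering edge has to run in [e],
    and at the right distance. *)
Lemma interior_cover e u : u \in `]0, elen e[ -> ~ breakpoint e u ->
  exists2 f, host f = e & offset f < u < offset f + elen f.
Proof.
move=> uI nb; have [[y yE]|[f [t tI tE]]] := model_cover K (emap e u).
  by case: nb; exists y.
have := tE; rewrite (lies_in_emap (hostP f) tI).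
move=> /(emap_inj uI (lies_in_itv (hostP f) tI))[-> ->].
by exists f => //; move: tI; rewrite in_itv/= => /andP[? ?]; apply/andP; split; lra.
Qed.

(** Two edges that start at the same place overlap, hence are equal. *)
Lemma offset_uniq f f' : host f = host f' -> offset f = offset f' -> f = f'.
Proof.
move=> hh oo; have [t [t0 t1 t2]] : exists t, [/\ 0 < t, t < elen f & t < elen f'].
  have := elen_gt0 f; have := elen_gt0 f'.
  by case: (leP (elen f) (elen f')) => *;
    [exists (elen f / 2)|exists (elen f' / 2)]; split; lra.
have tI : t \in `]0, elen f[ by rewrite in_itv/= t0.
have tI' : t \in `]0, elen f'[ by rewrite in_itv/= t0.
apply: (emap_inj tI tI' _).1.
by rewrite (lies_in_emap (hostP f) tI) (lies_in_emap (hostP f') tI') hh oo.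
Qed.

Lemma breakpoint_tail f : breakpoint (host f) (offset f).
Proof. by exists (etail f); exact: tail_offset. Qed.

Lemma breakpoint_head f : breakpoint (host f) (offset f + elen f).
Proof. by exists (ehead f); exact: head_offset. Qed.

(** As [K] has finitely many vertices, a point slightly to the right of [s] lies
    inside an edge of [K]. That edge starts at [s]: it starts at a breakpoint,
    there is none between [s] and the chosen point, and it cannot contain [s] in
    its interior. *)
Lemma edge_at e s : breakpoint e s -> 0 <= s < elen e ->
  exists2 f, host f = e & offset f = s.
Proof.
move=> bs /andP[s0 sl].
(* [pos x] is the position of [x] if [x] lies on [e] strictly between [s] and the
   head, and the end of [e] in the other cases. The least of these bounds an
   interval to the right of [s] free of vertices. *)
have ex x : exists u, s < u <= elen e /\
    forall v, s < v < elen e -> vmap (m:=K) x = emap e v -> v = u.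
  have [[v [/andP[v1 v2] vE]]|n] := pselect (exists v, s < v < elen e /\ vmap x = emap e v).
    exists v; split; first by rewrite v1 ltW.
    move=> v' /andP[v1' v2'] vE'.
    have I w : s < w -> w < elen e -> w \in `]0, elen e[.
      by move=> ? ?; rewrite in_itv/=; apply/andP; split; lra.
    by apply: (emap_inj (I _ v1' v2') (I _ v1 v2) _).2; rewrite -vE.
  exists (elen e); split; first by rewrite sl lexx.
  by move=> v vI vE; case: n; exists v.
pose pos x := projT1 (cid (ex x)).
have posP x : s < pos x <= elen e /\
    forall v, s < v < elen e -> vmap x = emap e v -> v = pos x.
  exact: (projT2 (cid (ex x))).
case: (bs) => y0 _.
pose ym := [arg min_(y < y0) pos y]%O.
have ymP y : pos ym <= pos y by rewrite /ym; case: arg_minP => // i _; apply.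
have [/andP[m1 m2] _] := posP ym.
pose u := (s + pos ym) / 2.
have noB v : s < v < pos ym -> ~ breakpoint e v.
  move=> /andP[v1 v2] [y yE]; have [_ /(_ v)] := posP y.
  rewrite v1 (lt_le_trans v2 m2) => /(_ isT yE) vE.
  by have := ymP y; rewrite -vE leNgt v2.
have uI : u \in `]0, elen e[ by rewrite in_itv/= /u; apply/andP; split; lra.
have [|f he /andP[of1 of2]] := interior_cover uI.
  by apply: noB; rewrite /u; apply/andP; split; lra.
exists f => //; case: (ltgtP (offset f) s) => // os.
  have /negP[] : ~~ (offset f < s < offset f + elen f).
    by apply: breakpoint_interior; rewrite he.
  by rewrite os (lt_trans _ of2)// /u; lra.
case: (noB (offset f)); last by rewrite -he; exact: breakpoint_tail.
by rewrite os (lt_trans of1)// /u; lra.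
Qed.

Fixpoint fills (e : edge G) (s : R) (l : seq (edge K)) : Prop :=
  if l is f :: l' then [/\ host f = e, offset f = s & fills e (s + elen f) l']
  else s = elen e.

(** Each step takes the edge starting at the current breakpoint; the recursion
    stops because one edge fewer lies ahead. *)
Lemma fills_exists e s : breakpoint e s -> 0 <= s <= elen e -> exists l, fills e s l.
Proof.
have [n] := ubnP #|[pred f : edge K | (host f == e) && (s <= offset f)]|.
elim: n s => // n IH s /ltnSE cn bs /andP[s0]; rewrite le_eqVlt => /predU1P[->|sl].
  by exists [::].
have [|f he os] := edge_at bs; first by rewrite s0.
have f0 := elen_gt0 f; have [_ fl _] := hostP f; rewrite he os in fl.
have [||//|l lE] := IH (s + elen f).
- rewrite (leq_trans _ cn)//; apply: proper_card; apply/properP; split.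
    apply/fintype.subsetP => g; rewrite !inE => /andP[-> ?]/=; lra.
  by exists f; rewrite !inE he eqxx os //= -ltNge; lra.
- by rewrite -os -he; exact: breakpoint_head.
- by rewrite fl andbT; lra.
- by exists (f :: l); split.
Qed.

Lemma fills_mem e s l f : fills e s l -> f \in l -> host f = e /\ s <= offset f.
Proof.
elim: l s => //= g l IH s [he os /IH h]; rewrite inE => /predU1P[->|/h[-> ?]].
  by rewrite os.
by split=> //; have := elen_gt0 g; lra.
Qed.

Lemma fills_uniq e s l : fills e s l -> uniq l.
Proof.
elim: l s => //= g l IH s [he os h]; rewrite (IH _ h) andbT; apply/negP => /(fills_mem h)[_].
by rewrite os; have := elen_gt0 g; lra.
Qed.

(** An edge running in [e] and absent from the list would start strictly inside
    an edge of the list. *)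
Lemma fills_complete e s l f : fills e s l -> host f = e -> s <= offset f -> f \in l.
Proof.
move=> + he; elim: l s => [s /= ->|g l IH s /= [hg os h]] sf.
  by have [_] := hostP f; have := elen_gt0 f; rewrite he; lra.
rewrite inE; case: eqVneq => //= fg; apply: (IH (s + elen g)) => //.
rewrite leNgt; apply/negP => lt.
have : ~~ (offset g < offset f < offset g + elen g).
  by apply: breakpoint_interior; rewrite hg -he; exact: breakpoint_tail.
rewrite os lt andbT -leNgt => fs; case/eqP: fg; apply: offset_uniq; first by rewrite he.
by rewrite os; apply/eqP; rewrite eq_le sf fs.
Qed.

Lemma fills_walk e s l x y : fills e s l -> vmap x = emap e s ->
  vmap y = emap e (elen e) -> @walk R K x l y.
Proof.
elim: l s x => [s x /= ->|g l IH s x /= [hg os h]] xE yE.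
  by apply/eqP/(@vmap_inj _ _ K); rewrite xE yE.
rewrite (IH _ _ h) ?andbT//; last by rewrite head_offset hg os.
by apply/eqP/(@vmap_inj _ _ K); rewrite tail_offset hg os xE.
Qed.

Lemma fills_sum e s l : fills e s l -> \sum_(f <- l) elen f = elen e - s.
Proof.
elim: l s => [s /= ->|g l IH s /= [_ _ /IH h]]; first by rewrite big_nil subrr.
by rewrite big_cons h; lra.
Qed.

Lemma fills_offset e s l s1 f s2 : fills e s l -> l = s1 ++ f :: s2 ->
  offset f = s + \sum_(g <- s1) elen g.
Proof.
move=> + E; rewrite {}E; elim: s1 s => [s /= [_ -> _]|g l' IH s /= [_ _ /IH ->]].
  by rewrite big_nil addr0.
by rewrite big_cons addrA.
Qed.

Lemma finer_vertex (x : vertex G) : exists y : vertex K, vmap y = vmap x.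
Proof.
have [[y ->]|[f [t tI tE]]] := model_cover K (vmap x); first by exists y.
have tI' := lies_in_itv (hostP f) tI; case: (vmap_emap (x := x) tI').
by rewrite tE; exact: (lies_in_emap (hostP f) tI).
Qed.

Definition finer_vertex_map x : vertex K := projT1 (cid (finer_vertex x)).
Lemma finer_vertex_mapE x : vmap (finer_vertex_map x) = vmap x.
Proof. exact: (projT2 (cid (finer_vertex x))). Qed.

Lemma finer_edge_ex (e : edge G) : exists l, fills e 0 l.
Proof.
apply: fills_exists; last by rewrite lexx ltW// elen_gt0.
by exists (finer_vertex_map (etail e)); rewrite finer_vertex_mapE emap_tail.
Qed.

Definition pieces e : seq (edge K) := projT1 (cid (finer_edge_ex e)).
Lemma piecesP e : fills e 0 (pieces e).
Proof. exact: (projT2 (cid (finer_edge_ex e))). Qed.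

Lemma host_lies_in (f : edge K) (e : edge G) a : lies_in f e a -> host f = e.
Proof.
move=> fe; have f0 := elen_gt0 f.
have tI : elen f / 2 \in `]0, elen f[ by rewrite in_itv/=; apply/andP; split; lra.
apply: (emap_inj (lies_in_itv (hostP f) tI) (lies_in_itv fe tI) _).1.
by rewrite -(lies_in_emap (hostP f) tI) (lies_in_emap fe tI).
Qed.

Lemma mem_pieces e f : (f \in pieces e) = (host f == e).
Proof.
apply/idP/eqP => [/(fills_mem (piecesP e))[]//|h].
by apply: (fills_complete (piecesP e) h); have [] := hostP f.
Qed.

Lemma mem_behead_pieces e f : (f \in behead (pieces e)) = (host f == e) && (0 < offset f).
Proof.
have := piecesP e; rewrite -mem_pieces.
case: (pieces e) => [//|g l] /= [hg og h]; rewrite inE.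
have g0 := elen_gt0 g.
apply/idP/andP => [fl|[/predU1P[->|//]]]; last by rewrite og ltxx.
by rewrite fl orbT; have [_ ?] := fills_mem h fl; split=> //; lra.
Qed.

Lemma pieces_walk e :
  walk (finer_vertex_map (etail e)) (pieces e) (finer_vertex_map (ehead e)).
Proof.
by apply: fills_walk (piecesP e) _ _; rewrite finer_vertex_mapE ?emap_tail ?emap_head.
Qed.

Lemma pieces_elen e : \sum_(f <- pieces e) elen f = elen e.
Proof. by rewrite (fills_sum (piecesP e)) subr0. Qed.

(** Every edge of [K] is a piece of its host and of no other edge. *)
Lemma pieces_edges :
  perm_eq (flatten [seq pieces e | e <- enum (edge G)]) (enum (edge K)).
Proof.
apply: uniq_perm; rewrite ?enum_uniq//.
  apply: flatten_uniq => [|e|i j f]; first exact: enum_uniq.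
    exact: fills_uniq (piecesP e).
  by rewrite !mem_pieces => /eqP <- /eqP.
move=> f; rewrite mem_enum; apply/flattenP; exists (pieces (host f)).
  by apply: map_f; rewrite mem_enum.
by rewrite mem_pieces.
Qed.

(** Only the first piece starts at the tail of [e]; the tails of the other ones are
    the new vertices on [e]. *)
Lemma behead_interior e f : f \in behead (pieces e) -> offset f \in `]0, elen e[.
Proof.
rewrite mem_behead_pieces => /andP[/eqP<- f0]; have [_ fl _] := hostP f.
by rewrite in_itv/= f0; have := elen_gt0 f; lra.
Qed.

Lemma pieces_vertices : perm_eq
  ([seq finer_vertex_map x | x <- enum (vertex G)] ++
   flatten [seq [seq etail e' | e' <- behead (pieces e)] | e <- enum (edge G)])
  (enum (vertex K)).
Proof.
rewrite (_ : flatten _ = map (fun f : edge K => etail f)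
    (flatten [seq behead (pieces e) | e <- enum (edge G)])); last first.
  by rewrite map_flatten -map_comp.
apply: uniq_perm; rewrite ?enum_uniq//.
  rewrite cat_uniq; apply/and3P; split.
  - rewrite map_inj_uniq ?enum_uniq// => x y xy; apply: (@vmap_inj _ _ G).
    by rewrite -!finer_vertex_mapE xy.
  - apply/hasPn => _ /mapP[f /flattenP[_ /mapP[e _ ->] fe] ->].
    apply/negP => /mapP[x _ xE]; apply: (vmap_emap (x := x) (behead_interior fe)).
    rewrite -finer_vertex_mapE -xE tail_offset.
    by move: fe; rewrite mem_behead_pieces => /andP[/eqP-> _].
  rewrite map_inj_in_uniq.
    apply: flatten_uniq => [|e|i j f]; first exact: enum_uniq.
      by have := fills_uniq (piecesP e); case: (pieces e) => //= ? ? /andP[].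
    by rewrite !mem_behead_pieces => /andP[/eqP <- _] /andP[/eqP].
  move=> f g /flattenP[_ /mapP[e _ ->] fe] /flattenP[_ /mapP[e' _ ->] ge'] fg.
  have hf : host f = e by move: fe; rewrite mem_behead_pieces => /andP[/eqP].
  have hg : host g = e' by move: ge'; rewrite mem_behead_pieces => /andP[/eqP].
  have := tail_offset f; rewrite [etail f]fg tail_offset hf hg.
  move=> /(emap_inj (behead_interior ge') (behead_interior fe))[ee oo].
  by apply: offset_uniq => //; rewrite hf hg.
move=> y; rewrite mem_enum mem_cat; apply/orP.
have [[x xE]|[e [u uI uE]]] := model_cover G (vmap y); [left|right].
  apply/mapP; exists x; first by rewrite mem_enum.
  by apply: (@vmap_inj _ _ K); rewrite xE finer_vertex_mapE.
have /andP[u0 ul] : 0 < u < elen e by move: uI; rewrite in_itv.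
have [f hf of_] : exists2 f, host f = e & offset f = u.
  by apply: edge_at; [exists y|rewrite ltW].
apply/mapP; exists f; last first.
  by apply: (@vmap_inj _ _ K); rewrite tail_offset hf of_.
apply/flattenP; exists (behead (pieces e)); first by apply: map_f; rewrite mem_enum.
by rewrite mem_behead_pieces hf eqxx of_.
Qed.

Definition finer_subdivision : subdivision G K :=
  Subdivision pieces_walk pieces_elen pieces_edges pieces_vertices.

Lemma finer_ref_edge e s1 f s2 : sub_edge finer_subdivision e = s1 ++ f :: s2 ->
  forall t, t \in `[0, elen f] -> emap f t = emap e (\sum_(g <- s1) elen g + t).
Proof.
move=> /= E t tI; have := fills_offset (piecesP e) E; rewrite add0r => <-.
have /eqP<- : host f == e by rewrite -mem_pieces E mem_cat mem_head orbT.
by have [_ _ ->] := hostP f.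
Qed.

Definition finer_refinement : refinement G K :=
  @Refinement _ _ G K finer_subdivision finer_vertex_mapE finer_ref_edge.

End FinerRefinement.

End Refinement.

(** * Cutting an edge at an interior point *)

Section Cut.
Variables (R : realType) (Gamma : tropicalCurve R) (G : model Gamma).
Variables (e0 : edge G) (c : R).
Hypothesis cI : c \in `]0, elen e0[.

(* The old vertices and edges keep their indices and the last index is new. On
   edges, the old index of [e0] is given to its first piece. *)
Let old (n : nat) (i : 'I_n) : 'I_n.+1 := lift ord_max i.

Definition cut_elen (f : 'I_(nedge G).+1) : R :=
  if unlift ord_max f is Some e then if e == e0 then c else elen e else elen e0 - c.
Definition cut_tail (f : 'I_(nedge G).+1) : 'I_(nvertex G).+1 :=
  if unlift ord_max f is Some e then old (etail e) else ord_max.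
Definition cut_head (f : 'I_(nedge G).+1) : 'I_(nvertex G).+1 :=
  if unlift ord_max f is Some e then if e == e0 then ord_max else old (ehead e)
  else old (ehead e0).
Definition cut_host (f : 'I_(nedge G).+1) : edge G := odflt e0 (unlift ord_max f).
Definition cut_offset (f : 'I_(nedge G).+1) : R := if unlift ord_max f then 0 else c.

Lemma cut_gt0 : 0 < c. Proof. by move: cI; rewrite in_itv/= => /andP[]. Qed.
Lemma cut_lt : c < elen e0. Proof. by move: cI; rewrite in_itv/= => /andP[]. Qed.

Lemma cut_elen_gt0 f : 0 < cut_elen f.
Proof.
rewrite /cut_elen; case: unlift => [e|]; last by rewrite subr_gt0 cut_lt.
by case: eqP => _; [exact: cut_gt0|exact: elen_gt0].
Qed.

Let adj (x y : 'I_(nvertex G).+1) :=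
  [exists f, (cut_tail f == x) && (cut_head f == y) || (cut_tail f == y) && (cut_head f == x)].

Let adj_sym x y : connect adj x y = connect adj y x.
Proof.
apply: sym_connect_sym => {}x {}y; apply: eq_existsb => f.
by rewrite orbC.
Qed.

Let adj_edge f : connect adj (cut_tail f) (cut_head f).
Proof. by apply: connect1; apply/existsP; exists f; rewrite !eqxx. Qed.

Lemma cut_connected (x y : 'I_(nvertex G).+1) : connect adj x y.
Proof.
have E e : connect adj (old (etail e)) (old (ehead e)).
  have := adj_edge (old e); rewrite /cut_tail /cut_head /old liftK.
  case: eqP => [->|//] /connect_trans; apply.
  by have := adj_edge ord_max; rewrite /cut_tail /cut_head unlift_none.
have O (a b : 'I_(nvertex G)) : connect adj (old a) (old b).
  have /connectP[p] := wgraph_connected a b.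
  elim: p a => [a _ ->|z p IH a /= /andP[/existsP[e he] /IH h bE]]; first exact: connect0.
  apply: connect_trans (h bE).
  by case/orP: he => /andP[/eqP<- /eqP<-] //; rewrite adj_sym.
have N (a : 'I_(nvertex G)) : connect adj (old a) ord_max.
  apply: connect_trans (O a (ehead e0)) _; rewrite adj_sym.
  by have := adj_edge ord_max; rewrite /cut_tail /cut_head unlift_none.
case: (unliftP ord_max x) => [a|] ->; case: (unliftP ord_max y) => [b|] ->.
- exact: O.
- exact: N.
- by rewrite adj_sym; exact: N.
- exact: connect0.
Qed.

Definition cut_graph : wgraph R :=
  @WGraph R _ _ cut_elen cut_tail cut_head cut_elen_gt0 isT cut_connected.

Definition cut_vmap (x : vertex cut_graph) : Gamma :=
  if unlift ord_max x is Some y then vmap y else emap e0 c.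
Definition cut_emap (f : edge cut_graph) (t : R) : Gamma :=
  emap (cut_host f) (cut_offset f + t).

Lemma cut_emap_tail f : cut_emap f 0 = cut_vmap (etail f).
Proof.
rewrite /cut_emap /cut_vmap /= addr0 /cut_tail /cut_host /cut_offset.
case: (unlift _ f) => [e|]; rewrite ?unlift_none// /old liftK.
exact: emap_tail.
Qed.

Lemma cut_emap_head f : cut_emap f (elen f) = cut_vmap (ehead f).
Proof.
rewrite /cut_emap /cut_vmap /= /cut_head /cut_host /cut_offset /cut_elen.
case: (unlift _ f) => [e|] /=; rewrite ?liftK ?add0r.
  by case: eqP => [->|_]; rewrite ?unlift_none// /old ?liftK emap_head.
by rewrite /old ?liftK addrC subrK emap_head.
Qed.

Lemma cut_lies f : 0 <= cut_offset f /\ cut_offset f + cut_elen f <= elen (cut_host f).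
Proof.
have := cut_gt0; have := cut_lt; rewrite /cut_host /cut_offset /cut_elen.
case: (unlift _ f) => [e|] /=; last by move=> *; split; lra.
by case: eqP => [->|_]; split; lra.
Qed.

Lemma cut_itv f t : t \in `]0, cut_elen f[ -> cut_offset f + t \in `]0, elen (cut_host f)[.
Proof.
have [? ?] := cut_lies f; rewrite !in_itv/= => /andP[? ?]; apply/andP; split; lra.
Qed.

Lemma cut_itv_neq f t : t \in `]0, cut_elen f[ -> cut_host f = e0 -> cut_offset f + t <> c.
Proof.
rewrite in_itv/= /cut_elen /cut_host /cut_offset; case: (unlift _ f) => [e|]/= /andP[t0 tl] ee.
  by move: tl; rewrite ee eqxx; lra.
by lra.
Qed.

Lemma cut_vmap_inj : injective cut_vmap.
Proof.
move=> x y; rewrite /cut_vmap.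
case: (unliftP ord_max x) => [a|] ->; case: (unliftP ord_max y) => [b|] -> //.
- by move=> /(@vmap_inj _ _ G)->.
- by move=> /(vmap_emap cI).
- by move=> /esym/(vmap_emap cI).
Qed.

Lemma cut_emap_inj f f' s t : s \in `]0, cut_elen f[ -> t \in `]0, cut_elen f'[ ->
  cut_emap f s = cut_emap f' t -> f = f' /\ s = t.
Proof.
move=> sI tI /(emap_inj (cut_itv sI) (cut_itv tI)).
move: sI tI; rewrite !in_itv/= /cut_elen /cut_host /cut_offset.
case: (unliftP ord_max f) => [e|] ->; case: (unliftP ord_max f') => [e'|] -> /=.
- by rewrite !add0r => _ _ [-> ->].
- by move=> /andP[? si] /andP[? ?] [ee]; move: si; rewrite ee eqxx; lra.
- by move=> /andP[? ?] /andP[? si] [ee]; move: si; rewrite -ee eqxx; lra.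
- by move=> _ _ [_ /addrI->].
Qed.

Lemma cut_vmap_emap x f t : t \in `]0, cut_elen f[ -> cut_vmap x <> cut_emap f t.
Proof.
move=> tI; rewrite /cut_vmap /cut_emap; case: unlift => [y|].
  exact/vmap_emap/cut_itv.
move=> /(emap_inj cI (cut_itv tI))[hE oE].
by apply: (cut_itv_neq tI) => //; rewrite -hE.
Qed.

Lemma cut_cover p : (exists x, p = cut_vmap x) \/
  (exists f, exists2 t, t \in `]0, cut_elen f[ & p = cut_emap f t).
Proof.
rewrite /cut_vmap /cut_emap.
have [[x ->]|[e [t tI ->]]] := model_cover G p.
  by left; exists (old x); rewrite /old liftK.
have /andP[t0 tl] : 0 < t < elen e by move: tI; rewrite in_itv.
have [ee|ne] := eqVneq e e0; last first.
  right; exists (old e), t; rewrite /cut_elen /cut_host /cut_offset /old liftK.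
    by rewrite (negPf ne).
  by rewrite add0r.
case: (ltgtP t c) => tc.
- right; exists (old e), t; rewrite /cut_elen /cut_host /cut_offset /old liftK.
    by rewrite ee eqxx in_itv/= t0.
  by rewrite add0r.
- right; exists ord_max, (t - c); rewrite /cut_elen /cut_host /cut_offset unlift_none.
    by rewrite in_itv/= -ee; lra.
  by rewrite /= -ee addrC subrK.
by left; exists ord_max; rewrite unlift_none ee tc.
Qed.

(** The constructor [chain_step] with its indices up to provable equality, since
   the same point and the same length occur in different forms. *)
Lemma chain_step_eq (K : wgraph R) (phi : edge K -> R -> Gamma) p q r e s t L L' :
  chain_length phi p q L -> s \in `[0, elen e] -> t \in `[0, elen e] ->
  q = phi e s -> r = phi e t -> L' = L + `|s - t| -> chain_length phi p r L'.
Proof. by move=> h sI tI qE -> ->; apply: chain_step sI tI; rewrite -qE. Qed.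

(** A step in the cut model is a step in [G]. Conversely, a step along [e0] that
    passes the point [c] splits there into two steps, of the same total length.
    So both models have the same chain lengths between two points, and with
    them the same metric. *)
Lemma cut_chain p q L :
  chain_length cut_emap p q L <-> chain_length (@emap _ _ G) p q L.
Proof.
split; elim=> {q L} [|f s t L _ IH]; try exact: chain_nil.
  rewrite !in_itv/= => /andP[s0 sl] /andP[t0 tl]; have [? ?] := cut_lies f.
  apply: (chain_step_eq (e := cut_host f) (s := cut_offset f + s)
    (t := cut_offset f + t) IH) => //; rewrite ?in_itv/=; try by apply/andP; split; lra.
  by congr (_ + `|_|); lra.
rewrite !in_itv/= => /andP[s0 sl] /andP[t0 tl].
have [c0 cl] := (cut_gt0, cut_lt).
have first_piece u : cut_emap (old f) u = emap f u.
  by rewrite /cut_emap /cut_host /cut_offset /old liftK add0r.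
have [fe|ne] := eqVneq f e0; last first.
  by apply: (chain_step_eq (e := old f : edge cut_graph) (s := s) (t := t) IH);
    rewrite ?first_piece// in_itv/= /cut_elen /old liftK (negPf ne); apply/andP.
have last_piece u : cut_emap ord_max u = emap f (c + u).
  by rewrite /cut_emap /cut_host /cut_offset unlift_none fe.
have first_itv u : 0 <= u -> u <= c -> u \in `[0, cut_elen (old f)].
  by move=> ? ?; rewrite in_itv/= /cut_elen /old liftK fe eqxx; apply/andP.
have last_itv u : c <= u -> u <= elen f -> u - c \in `[0, cut_elen ord_max].
  by move=> ? ?; rewrite in_itv/= /cut_elen unlift_none -fe; apply/andP; split; lra.
have C : emap f c = cut_emap (old f) c by rewrite first_piece.
have C' : emap f c = cut_emap ord_max (c - c) by rewrite last_piece subrr addr0.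
have last_piece' u : emap f u = cut_emap ord_max (u - c).
  by rewrite last_piece addrC subrK.
have low r u v l : 0 <= u <= c -> 0 <= v <= c ->
    chain_length cut_emap r (emap f u) l ->
    chain_length cut_emap r (emap f v) (l + `|u - v|).
  move=> /andP[? ?] /andP[? ?] h.
  by apply: (chain_step_eq (e := old f : edge cut_graph) (s := u) (t := v) h);
    rewrite ?first_piece//; exact: first_itv.
have high r u v l : c <= u <= elen f -> c <= v <= elen f ->
    chain_length cut_emap r (emap f u) l ->
    chain_length cut_emap r (emap f v) (l + `|u - v|).
  move=> /andP[? ?] /andP[? ?] h.
  apply: (chain_step_eq (e := ord_max : edge cut_graph) (s := u - c) (t := v - c) h);
    rewrite -?last_piece'//; [exact: last_itv|exact: last_itv|].
  by congr (_ + `|_|); lra.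
have [sc|cs] := leP s c; have [tc|ct] := leP t c.
- by apply: low IH; apply/andP.
- rewrite (_ : L + _ = L + `|s - c| + `|c - t|); last first.
    by rewrite !ler0_norm; lra.
  by apply: high; [| |apply: low IH]; apply/andP; split; lra.
- rewrite (_ : L + _ = L + `|s - c| + `|c - t|); last first.
    by rewrite !ger0_norm; lra.
  by apply: low; [| |apply: high IH]; apply/andP; split; lra.
- by apply: high IH; apply/andP; split; lra.
Qed.

Lemma cut_isometry p q : mdist p q = inf [set L : R | chain_length cut_emap p q L]%classic.
Proof.
by rewrite (model_isometry G); congr inf; apply/seteqP; split=> L /= /cut_chain.
Qed.

Definition cut_model : model Gamma :=
  @Model R Gamma cut_graph cut_vmap cut_emap cut_emap_tail cut_emap_head cut_vmap_inj
    cut_emap_inj cut_vmap_emap cut_cover cut_isometry.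

Lemma finer_cut : finer G cut_model.
Proof.
by move=> f; exists (cut_host f), (cut_offset f); have [] := cut_lies f; split.
Qed.

Lemma cut_vertex : exists x : vertex cut_model, vmap x = emap e0 c.
Proof. by exists ord_max; rewrite /= /cut_vmap unlift_none. Qed.

Lemma cut_edge : exists f : edge cut_model, lies_in f e0 0 /\ elen f = c.
Proof.
have E : cut_host (old e0) = e0 /\ cut_offset (old e0) = 0 /\ cut_elen (old e0) = c.
  by rewrite /cut_host /cut_offset /cut_elen /old liftK eqxx.
exists (old e0); split; last by rewrite /= E.2.2.
have := cut_lies (old e0); rewrite E.1 E.2.1 E.2.2 => -[h0 hl].
by split; rewrite /= ?E.2.2// => t _; rewrite /cut_emap E.1 E.2.1.
Qed.

End Cut.

(** * The models are directed *)

Section Directed.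
Variables (R : realType) (Gamma : tropicalCurve R).
Implicit Types G H K : model Gamma.

Lemma finer_with_point G (p : Gamma) :
  exists K, finer G K /\ exists x : vertex K, vmap x = p.
Proof.
have [[x ->]|[e [t tI ->]]] := model_cover G p.
  by exists G; split; [exact: finer_refl|exists x].
by exists (cut_model tI); split; [exact: finer_cut|exact: cut_vertex].
Qed.

Lemma finer_with_vertices G H :
  exists K, finer G K /\ forall x : vertex H, exists y : vertex K, vmap y = vmap x.
Proof.
suff [K [GK KH]] : exists K, finer G K /\
    forall x : vertex H, x \in enum (vertex H) -> exists y : vertex K, vmap y = vmap x.
  by exists K; split=> // x; apply: KH; rewrite mem_enum.
elim: (enum _) => [|x r [K [GK Kr]]]; first by exists G; split=> //; exact: finer_refl.
have [K' [KK' [y yE]]] := finer_with_point K (vmap x).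
exists K'; split=> [|z]; first exact: finer_trans GK KK'.
rewrite inE => /predU1P[->|/Kr[w <-]]; first by exists y.
exact: finer_vertex KK' w.
Qed.

(** Below a common model [G], being finer is decided by the vertices: an edge [f]
    of [K] meets the interior of some edge [g] of [H] in the same edge of [G],
    and if [f] were not contained in [g] an end of [g] would be a vertex of [H],
    hence of [K], inside [f]. *)
Lemma finer_of_vertices G H K : finer G H -> finer G K ->
  (forall x : vertex H, exists y : vertex K, vmap y = vmap x) -> finer H K.
Proof.
move=> GH GK HK f; have [e [a fe]] := GK f; have f0 := elen_gt0 f.
have noH (x : vertex H) u : 0 < u < elen f -> vmap x <> emap f u.
  by have [y <-] := HK x; move=> uI; apply: vmap_emap; rewrite in_itv.
pose t := elen f / 2.
have tI : t \in `]0, elen f[ by rewrite in_itv/= /t; apply/andP; split; lra.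
have [[x xE]|[g [s sI sE]]] := model_cover H (emap f t).
  by case: (noH x t); rewrite ?xE//; move: tI; rewrite in_itv.
have [e' [b ge]] := GH g.
move: sE; rewrite (lies_in_emap fe tI) (lies_in_emap ge sI).
move=> /(emap_inj (lies_in_itv fe tI) (lies_in_itv ge sI))[ee st].
rewrite -{}ee in ge; exists g.
have [a0 al fE] := fe; have [b0 bl gE] := ge; have g0 := elen_gt0 g.
move: tI sI; rewrite !in_itv/= => /andP[t0 tl] /andP[s0 sl].
have ba : b <= a.
  rewrite leNgt; apply/negP => ab; apply: (noH (etail g) (b - a)); first by lra.
  rewrite -emap_tail gE ?in_itv/= ?lexx ?ltW// addr0 fE ?in_itv/=; last by lra.
  by congr emap; lra.
have ab : a + elen f <= b + elen g.
  rewrite leNgt; apply/negP => ab; apply: (noH (ehead g) (b + elen g - a)); first by lra.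
  rewrite -emap_head gE ?in_itv/= ?lexx ?ltW// fE ?in_itv/=; last by lra.
  by congr emap; lra.
exists (a - b); split; [lra|lra|] => u; rewrite in_itv/= => /andP[u0 ul].
rewrite fE ?in_itv/= ?u0// gE ?in_itv/=; last by lra.
by congr emap; lra.
Qed.

Variable G0 : model Gamma.

Lemma finer_compatible K : finer G0 K -> common_refinement K G0.
Proof.
by exists K; split; exists; [exact: ref_refl|exact: finer_refinement].
Qed.

(** Given models [H] and [H'] that refine [G0], cutting [H] at the vertices of [H']
    gives a model finer than both. *)
Lemma compatible_model_directed (G G' : compatible_model G0) :
  exists K : compatible_model G0, inhabited (refinement G K) /\ inhabited (refinement G' K).
Proof.
have [H [[GH] [G0H]]] := compatible_model_refine G.
have [H' [[GH'] [G0H']]] := compatible_model_refine G'.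
have [K [HK H'K]] := finer_with_vertices H H'.
have G0K : finer G0 K by apply: finer_trans HK; exact: refinement_finer.
exists (CompatibleModel (finer_compatible G0K)); split; exists; apply: finer_refinement.
  by apply: finer_trans HK; exact: refinement_finer.
apply: (finer_trans (refinement_finer GH')).
exact: finer_of_vertices (refinement_finer G0H') G0K H'K.
Qed.

End Directed.

(** * Injectivity on each model *)

Section JacobianMap.
Variables (R : realType) (Gamma : tropicalCurve R) (G0 : model Gamma).

Lemma jac_in_trans (G G' : compatible_model G0) (rho : refinement G G') x :
  jac_in G' (jac_trans rho x) = jac_in G x.
Proof.
apply/esym/eqP; rewrite /jac_in /colim_in colim_piE; apply/asboolP => A _; apply.
by exists G, G', rho, x.
Qed.

Lemma Omega_out_push (G G' : compatible_model G0) (rho : refinement G G') w :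
  Omega_out G' w = Omega_push rho (Omega_out G w).
Proof.
by rewrite -[in LHS](Omega_outK G w) -(Omega_in_push rho) Omega_inK.
Qed.

Lemma dual_transfer_push (G G' : compatible_model G0) (rho : refinement G G')
    (a : chains G int) :
  dual_transfer G' (integralZ (push rho a)) = dual_transfer G (integralZ a).
Proof.
apply: val_inj; apply/funext => w.
rewrite -[LHS]/(integralZ (push rho a) (Omega_out G' w)).
by rewrite (Omega_out_push rho) integralZ_push.
Qed.

Lemma jac_map_trans (G G' : compatible_model G0) (rho : refinement G G') x :
  jac_map G' (jac_trans rho x) = jac_map G x.
Proof.
rewrite -[x]jac_reprK jac_trans_class (jac_map_class (push rho _)).
by rewrite (jac_map_class (jac_repr x)) dual_transfer_push.
Qed.

(** Integrals determine classes: if the integral along an integral chain of [G] is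
    that along a cycle [h] of [G0], then [h], carried to [G] through a common
    refinement, is a cycle of [G] with the same integral. *)
Lemma jac_map_inj (G : compatible_model G0) : injective (jac_map G).
Proof.
move=> x y; rewrite -[x]jac_reprK -[y]jac_reprK.
move: (jac_repr x) (jac_repr y) => a b {x y}; rewrite (jac_map_class a) (jac_map_class b).
move=> /jacGamma_classP; rewrite -pullbackB -raddfB => /asboolP[h hh E].
have [H [[r] [r0]]] := compatible_model_refine G.
apply/jac_classP; exists (pull r (push r0 h)); first exact/pull_H1/push_H1.
apply: val_inj; apply/funext => w.
rewrite -[RHS](integralZ_push r) pullK; last exact: push_H1.
rewrite integralZ_pull -E.
rewrite -[RHS]/(integralZ (a - b) (Omega_out G (Omega_in (base G0) _))).
by rewrite -(Omega_in_push r0) Omega_pullK (Omega_in_push r) Omega_inK.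
Qed.

(** Directedness makes the colimit a union of the images of the [jac G]. *)
Lemma jac_colim_in (z : jac_colim G0) :
  exists (G : compatible_model G0) (x : jac G), z = jac_in G x.
Proof.
elim/colim_ind: z => [|_ _ [G [x ->]] [G' [y ->]]|G x].
- by exists (base G0), 0; rewrite raddf0.
- have [K [[r] [r']]] := compatible_model_directed G G'.
  exists K, (jac_trans r x + jac_trans r' y).
  by rewrite raddfD /= !jac_in_trans.
by exists G, x.
Qed.

End JacobianMap.

(** * Linear forms are integrals along real chains *)

Section LinearForms.
Variables (R : realType) (G : wgraph R).

Let bdry (w : forms G) : {ffun vertex G -> R^o} := dstar (w : chains G R^o).

Lemma bdry_is_linear : linear bdry.
Proof.
move=> a u v; apply/ffunP => x; rewrite !ffunE scalerBr !scaler_sumr.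
rewrite addrACA -opprD -!big_split /=.
by congr (_ - _); apply: eq_bigr => e _; rewrite !ffunE.
Qed.

HB.instance Definition _ := GRing.isLinear.Build R (forms G) {ffun vertex G -> R^o} _
  bdry bdry_is_linear.

Let cycles := lker (linfun bdry).

Lemma cyclesE w : (w \in cycles) = (w \in Defs.harmonic (G:=G)).
Proof. by rewrite memv_ker lfunE /=; apply/eqP/harmonicP. Qed.

Fact harmonic_proj_subproof w : projv cycles w \in Defs.harmonic (G:=G).
Proof. by rewrite -cyclesE memv_proj. Qed.

Definition harmonic_proj (w : forms G) : Omega G := MkOmega (harmonic_proj_subproof w).

Lemma harmonic_proj_id (w : Omega G) : harmonic_proj w = w.
Proof. by apply: val_inj; rewrite /= projv_id// cyclesE; case: w. Qed.

(** A linear form on the harmonic forms extends to all 1-forms through a linear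
    projection onto the harmonic ones. *)
Definition extend_form (l : dual (Omega G)) (w : forms G) : R^o := l (harmonic_proj w).

Lemma extend_form_is_linear l : linear (extend_form l).
Proof.
move=> a u v; have /asboolP linl := valP l; rewrite -linl; congr (val l _).
by apply: val_inj; rewrite /= linearP.
Qed.

HB.instance Definition _ l := GRing.isLinear.Build R (forms G) R^o _
  (extend_form l) (@extend_form_is_linear l).

(** Integration along real chains realizes every linear form on all 1-forms, the
    chain having the value of the form on [de] divided by the length of [e] as
    its coefficient at [e]. *)
Lemma integral_surj (l : dual (Omega G)) : exists a : chains G R, l = Defs.integral a.
Proof.
pose d (e : edge G) : forms G := [ffun f => (f == e)%:R].
exists [ffun e => extend_form l (d e) / elen e].
apply: val_inj; apply/funext => w.
have -> : val l w = extend_form l w by rewrite /extend_form harmonic_proj_id.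
have -> : (w : forms G) = \sum_e w e *: d e.
  apply/ffunP => f; rewrite sum_ffunE (bigD1 f)//= big1 ?addr0.
    by rewrite !ffunE eqxx [RHS]mulr1.
  by move=> e ne; rewrite !ffunE eq_sym (negPf ne) scaler0.
rewrite linear_sum; apply: eq_bigr => e _.
rewrite linearZ /= ffunE mulrAC divfK ?lt0r_neq0 ?elen_gt0//.
by rewrite [LHS]mulrC.
Qed.

End LinearForms.

(** * Classes of integrals reached by integral chains *)

Section Surjectivity.
Variables (R : realType) (Gamma : tropicalCurve R) (G0 : model Gamma).

Definition chain1 (A : zmodType) (G : wgraph R) (e : edge G) (t : A) : chains G A :=
  [ffun f => if f == e then t else 0].

Lemma integral_chain1 (G : wgraph R) (e : edge G) (t : R) (w : Omega G) :
  Defs.integral (chain1 e t) w = t * w e * elen e.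
Proof.
rewrite /= /integral_form (bigD1 e)//= ffunE eqxx big1 ?addr0// => f /negPf fe.
by rewrite ffunE fe !mul0r.
Qed.

Lemma ext_scalars_chain1 (G : wgraph R) (e : edge G) (n : int) :
  ext_scalars (chain1 e n) = chain1 e n%:~R.
Proof. by apply/ffunP => f; rewrite !ffunE; case: eqP. Qed.

Definition real_class (a : chains G0 R) : jacGamma G0 :=
  jacGamma_class (dual_transfer (base G0) (Defs.integral a)).

Definition reached (y : jacGamma G0) : Prop :=
  exists (G : compatible_model G0) (x : jac G), jac_map G x = y.

Lemma real_classD a b : real_class (a + b) = real_class a + real_class b.
Proof.
rewrite /real_class raddfD.
rewrite (_ : dual_transfer _ _ = dual_transfer (base G0) (Defs.integral a) +
  dual_transfer (base G0) (Defs.integral b)); last exact: val_inj.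
exact: (raddfD (\pi_(Quotient.quot (H1Gamma G0)))%qT).
Qed.

Lemma reachedD y z : reached y -> reached z -> reached (y + z).
Proof.
move=> [G [x <-]] [G' [x' <-]].
have [K [[r] [r']]] := compatible_model_directed G G'.
by exists K, (jac_trans r x + jac_trans r' x'); rewrite raddfD /= !jac_map_trans.
Qed.

Lemma reached_int (a : chains G0 int) : reached (real_class (ext_scalars a)).
Proof. by exists (base G0), (jac_class a); rewrite (jac_map_class (G:=base G0) a). Qed.

(** If [e] is cut at distance [t * elen e] from its tail, integrating a form along
    the whole first piece gives [t] times its integral along [e]. *)
Lemma reached_fraction (e : edge G0) (t : R) :
  0 < t < 1 -> reached (real_class (chain1 e t)).
Proof.
move=> /andP[t0 t1]; have e0 := elen_gt0 e.
have cI : t * elen e \in `]0, elen e[ by rewrite in_itv/= mulr_gt0//= gtr_pMl.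
have GK : finer G0 (cut_model cI) by exact: finer_cut.
have [f [fe fl]] : exists f : edge (cut_model cI), lies_in f e 0 /\ elen f = t * elen e.
  exact: cut_edge.
pose K : compatible_model G0 := CompatibleModel (finer_compatible GK).
pose r : refinement (base G0) K := finer_refinement GK.
exists K, (jac_class (chain1 (f : edge K) 1)); rewrite (jac_map_class (G:=K)).
congr jacGamma_class; apply: val_inj; apply/funext => w.
rewrite -[LHS]/(integralZ _ (Omega_out K w)).
rewrite -[RHS]/(Defs.integral _ (Omega_out (base G0) w)).
rewrite /integralZ ext_scalars_chain1 !integral_chain1 (Omega_out_push r) mul1r.
rewrite [elen f]fl mulrCA mulrA; congr (_ * _ * _).
have fp : f \in pieces GK e by rewrite mem_pieces (host_lies_in GK fe).
by rewrite /= (push_sub _ (fp : f \in sub_edge r e)).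
Qed.

Lemma reached_chain1 (e : edge G0) (t : R) : reached (real_class (chain1 e t)).
Proof.
have -> : chain1 e t =
    ext_scalars (chain1 e (Num.floor t)) + chain1 e (t - (Num.floor t)%:~R).
  apply/ffunP => f; rewrite !ffunE; case: eqP => _; last by rewrite addr0.
  by rewrite addrC subrK.
have [tz|tz] := eqVneq (t - (Num.floor t)%:~R) 0.
  rewrite tz (_ : chain1 e 0 = 0) ?addr0; first exact: reached_int.
  by apply/ffunP => f; rewrite !ffunE; case: ifP.
rewrite real_classD; apply: reachedD; first exact: reached_int.
apply: reached_fraction; rewrite lt_neqAle eq_sym tz subr_ge0 floor_le_tmp/=.
by rewrite ltrBlDl; have := floorD1_gt t; rewrite intrD.
Qed.

Lemma reached_real_class a : reached (real_class a).
Proof.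
have -> : a = \sum_e chain1 e (a e).
  apply/ffunP => f; rewrite sum_ffunE (bigD1 f)//= big1 ?addr0 ?ffunE ?eqxx//.
  by move=> e ne; rewrite ffunE eq_sym (negPf ne).
elim/big_ind: _ => [|x y hx hy|e _]; last exact: reached_chain1.
  have := reached_int 0; congr (reached (real_class _)).
  by apply/ffunP => e; rewrite !ffunE.
by rewrite real_classD; exact: reachedD.
Qed.

Lemma jac_map_jointly_surj (y : jacGamma G0) :
  exists (G : compatible_model G0) (x : jac G), jac_map G x = y.
Proof.
rewrite -[y](@reprK _ (Quotient.quot (H1Gamma G0))); move: (repr _) => l {y}.
have [a la] := integral_surj (pullback (Omega_in (base G0)) l).
have -> : l = dual_transfer (base G0) (Defs.integral a).
  apply: val_inj; apply/funext => w.
  by rewrite -la -[RHS]/(l (Omega_in (base G0) (Omega_out (base G0) w))) Omega_outK.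
exact: reached_real_class.
Qed.

End Surjectivity.

(** * The comparison isomorphism *)

Section Comparison.
Variables (R : realType) (Gamma : tropicalCurve R) (G0 : model Gamma).

(** The colimit is one of modules over the integers, so its universal property is
    about linear maps. *)
Definition jac_map_int (G : compatible_model G0) (x : zmodule (jac G)) :
  zmodule (jacGamma G0) := jac_map G x.

Lemma jac_map_int_is_linear (G : compatible_model G0) : linear (@jac_map_int G).
Proof.
move=> n x y; rewrite /jac_map_int !scalezrE [LHS](raddfD (jac_map G)).
by rewrite [X in X + _](raddfMz (jac_map G)).
Qed.

HB.instance Definition _ (G : compatible_model G0) :=
  GRing.isLinear.Build int (zmodule (jac G)) (zmodule (jacGamma G0)) _
    (@jac_map_int G) (@jac_map_int_is_linear G).

Let jac_diagram (G : compatible_model G0) : lmodType int := zmodule (jac G).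
Let jac_transition (G G' : compatible_model G0) (rho : refinement G G') :
  jac_diagram G -> jac_diagram G' := @jac_trans R G G' rho.
Let jac_cocone (G : compatible_model G0) :
  {linear jac_diagram G -> zmodule (jacGamma G0)} := @jac_map_int G.

Let jac_cocone_trans (G G' : compatible_model G0) (rho : refinement G G') x :
  jac_cocone G' (jac_transition rho x) = jac_cocone G x.
Proof. exact: jac_map_trans. Qed.

Definition jac_colim_map : jac_colim G0 -> jacGamma G0 :=
  colim_lift (f := jac_transition) jac_cocone.

Fact jac_colim_map_is_additive : zmod_morphism jac_colim_map.
Proof. exact: (colim_lift_is_additive jac_cocone_trans). Qed.

HB.instance Definition _ := GRing.isZmodMorphism.Build (jac_colim G0) (jacGamma G0)
  jac_colim_map jac_colim_map_is_additive.

Lemma jac_colim_map_in (G : compatible_model G0) x : jac_colim_map (jac_in G x) = jac_map G x.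
Proof. exact: (colim_lift_in jac_cocone_trans). Qed.

(** A class of the colimit comes from a single model, where [jac_map] is injective. *)
Lemma jac_colim_map_bij : bijective jac_colim_map.
Proof.
rewrite -setTT_bijective; split=> // [|y _]; last first.
  have [G [x <-]] := jac_map_jointly_surj y.
  by exists (jac_in G x) => //; exact: jac_colim_map_in.
apply: in2W; apply: raddf_inj => z.
have [G [x ->]] := jac_colim_in z; rewrite [X in X = _](jac_colim_map_in x) => x0.
suff -> : x = 0 by rewrite raddf0.
by apply: (@jac_map_inj _ _ _ G); rewrite x0 raddf0.
Qed.

End Comparison.

Theorem corollary3p3 (R : realType) (Gamma : tropicalCurve R) (G0 : model Gamma) :
  exists psi : {additive jac_colim G0 -> jacGamma G0},
    [/\ bijective psi,
        forall (G : compatible_model G0) (x : jac G), psi (jac_in G x) = jac_map G x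
      & forall G : compatible_model G0, injective (fun x : jac G => psi (jac_in G x))].
Proof.
exists (@jac_colim_map R Gamma G0); split.
- exact: jac_colim_map_bij.
- exact: jac_colim_map_in.
move=> G x y; rewrite [X in X = _](jac_colim_map_in x) [X in _ = X](jac_colim_map_in y).
exact: jac_map_inj.
Qed.
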